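(* Assume that $(\Sigma\times X,\widehat F)$ admits $\widehat\phi$-holonomies and that $F_\omega=F_{(\omega_i)_{i\le0}}$ (i.e. $F_\omega=F_{\omega'}$ whenever $\omega_i=\omega_i'$ for all $i\le0$). If $\widehat\phi(\omega,t)=\phi(\omega)$ for all $(\omega,t)\in\Sigma\times X$, then $\widehat P(\widehat\phi)=P(\phi)$, and any $\widehat F$-invariant Borel probability measure on $\Sigma\times X$ which attains the maximum in $$\max\Big\{\widehat h_{\widehat\eta}(\widehat F)+\int\widehat\phi\,d\widehat\eta:\ \widehat\eta\text{ is an }\widehat F\text{-invariant Borel probability measure}\Big\}$$ is future independent.
   Context: Setting: $\Sigma$ is a two-sided compact (finite alphabet), topologically transitive topological Markov shift with left shift $T:\Sigma\to\Sigma$; $X$ is a compact metric space; $\omega\mapsto F_\omega$ is a Hölder continuous map from $\Sigma$ into the space $C_\alpha(X,X)$ of $\alpha$-Hölder maps of $X$, where each $F_\omega$ is an $\alpha$-Hölder homeomorphism of $X$. The skew product is $\widehat F(\omega,t)=(T\omega,F_\omega(t))$ on $\Sigma\times X$. $\widehat\phi:\Sigma\times X\to\mathbb R$ is Hölder continuous and $\widehat\phi^{(n)}:=\sum_{k=0}^{n-1}\widehat\phi\circ\widehat F^k$. $\pi:\Sigma\times X\to\Sigma$ is the projection. Words: $\underline w$ ranges over admissible words of length $|\underline w|=n$, with $[\underline w]=\{\omega\in\Sigma:\omega_i=w_i,\ 0\le i\le n-1\}$. Pressures: $P(\phi)=\limsup_n\frac1n\log\sum_{|\underline w|=n}\exp\big(\max_{\omega\in[\underline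 w]}\sum_{k=0}^{n-1}\phi(T^k\omega)\big)$ is the usual pressure on $\Sigma$. The pressure out of equilibrium (POE) is $$\widehat P(\widehat\phi):=\limsup_{n\to\infty}\sup_{t\in X}\frac1n\log\sum_{|\underline w|=n}e^{\widehat\phi^{(n)}(\theta_{\underline w},t)},$$ where $\theta_{\underline w}=\theta_{\underline w}(t)\in[\underline w]$ maximizes $\omega\mapsto\widehat\phi^{(n)}(\omega,t)$ on $[\underline w]$. $\widehat\phi$-holonomies: there is $C>0$ such that for all $n\ge0$, $t\in X$ and $\omega,\omega'\in\Sigma$ with $\omega_i=\omega'_i$ for $0\le i\le n$, one has $|\widehat\phi^{(n)}(\omega,t)-\widehat\phi^{(n)}(\omega',t)|\le C$. Let $\Sigma^-=\{(\omega_i)_{i\le-1}:\omega\in\Sigma\}$ and, for $\omega^-\in\Sigma^-$, $V^u_{\le-1}(\omega^-)=\{\omega\in\Sigma:\omega_i=\omega^-_i\ \forall i\le-1\}$. Let $\widehat{\mathcal C}=\{[a]\times X\}_a$ ($a$ ranging over symbols) and $\widehat{\mathcal C}_n=\bigvee_{i=0}^{n-1}\widehat F^{-i}\widehat{\mathcal C}$. Metric entropy out of equilibrium: for an $\widehat F$-invariant Borel probability $\widehat\eta$ on $\Sigma\times X$ with disintegration $\widehat\eta=\int\eta_{(\omega^-,t)}\,d\tau(\omega^-,t)$ along $\{V^u_{\le-1}(\omega^-)\times\{t\}\}_{\omega^-\in\Sigma^-,\,t\in X}$, $$\widehat h_{\widehat\eta}(\widehat F):=\limsup_{n\to\infty}\int\frac1n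 \mathrm H_{\eta_{(\omega^-,t)}}(\widehat{\mathcal C}_n)\,d\tau(\omega^-,t),\qquad \mathrm H_\nu(\mathcal P)=-\sum_{A\in\mathcal P}\nu(A)\log\nu(A).$$ Future independence: with $\eta=\widehat\eta\circ\pi^{-1}$, write $\widehat\eta=\int\widehat\eta_{\omega^-}\,d\eta^-(\omega^-)$ for the disintegration along $\{V^u_{\le-1}(\omega^-)\times X\}_{\omega^-\in\Sigma^-}$ and $\eta=\int\eta_{\omega^-}\,d\eta^-(\omega^-)$ for the disintegration of $\eta$ along $\{V^u_{\le-1}(\omega^-)\}_{\omega^-\in\Sigma^-}$, where $\eta^-$ is the projection of $\eta$ to $\Sigma^-$. $\widehat\eta$ is future independent if for $\eta^-$-a.e. $\omega^-$ the measure $\widehat\eta_{\omega^-}$ is the product of $\eta_{\omega^-}$ on $V^u_{\le-1}(\omega^-)$ and some Borel probability measure $\sigma_{\omega^-}$ on $X$. *)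

(* Defs.v *)
From HB Require Import structures.
From mathcomp Require Import all_boot all_order all_algebra.
From mathcomp Require Import all_classical all_reals all_analysis.

Set Implicit Arguments.
Unset Strict Implicit.
Unset Printing Implicit Defensive.

Import Order.TTheory GRing.Theory Num.Theory.
Import numFieldTopology.Exports numFieldNormedType.Exports.

Local Open Scope classical_set_scope.
Local Open Scope ring_scope.

(* [borel o] is the topological space T with its Borel sigma-algebra. The point
   o only witnesses that T is nonempty, which [measurableType] requires; the
   sigma-algebra does not depend on it. *)
Definition borel (T : topologicalType) (o : T) : Type := T.

Section borel_instances.
Context (T : topologicalType) (o : T).

HB.instance Definition _ := Choice.copy (borel o) T.
HB.instance Definition _ := isPointed.Build (borel o) o.

Let borel0 : <<s @open T >> set0. Proof. exact: sigma_algebra0. Qed.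

Let borelC (B : set T) : <<s @open T >> B -> <<s @open T >> (~` B).
Proof. by move=> mB; rewrite -setTD; exact: sigma_algebraCD. Qed.

Let borelU (B : (set T)^nat) : (forall i, <<s @open T >> (B i)) ->
  <<s @open T >> (\bigcup_i B i).
Proof. exact: sigma_algebra_bigcup. Qed.

HB.instance Definition _ := @isMeasurable.Build (sigma_display (@open T))
  (borel o) <<s @open T >> borel0 borelC borelU.

End borel_instances.

Lemma continuous_measurable_borel (T U : topologicalType) (o : T) (u : U)
    (f : T -> U) : continuous f ->
  measurable_fun [set: borel o] (f : borel o -> borel u).
Proof.
move=> /continuousP cf.
apply: (@measurability _ _ (borel o) (borel u) _ _ (@open U)) => //.
move=> _ [B oB <-]; rewrite setTI; apply: sub_sigma_algebra; exact: cf.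
Qed.

(* [kappa] disintegrates mu along the partition into fibers of p, the quotient
   measure being the image of mu under p. *)
Definition is_disintegration d d' (S : measurableType d) (Q : measurableType d')
    (R : realType) (mu : probability S R) (p : {mfun S >-> Q})
    (kappa : R.-pker Q ~> S) : Prop :=
  (forall B, measurable B ->
     mu B = (\int[distribution mu p]_q kappa q B)%E) /\
  {ae distribution mu p, forall q, kappa q (p @^-1` [set q]) = 1%E}.

Definition holder (R : realType) (T U : Type) (dT : T -> T -> R)
    (dU : U -> U -> R) (alpha : R) (f : T -> U) : Prop :=
  exists C : R, forall x y, dU (f x) (f y) <= C * dT x y `^ alpha.

Definition holder_continuous (R : realType) (T U : Type) (dT : T -> T -> R)
    (dU : U -> U -> R) (f : T -> U) : Prop :=
  exists2 alpha : R, 0 < alpha <= 1 & holder dT dU alpha f.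

Definition homeomorphism (T U : topologicalType) (f : T -> U) : Prop :=
  continuous f /\
  exists g : U -> T, [/\ continuous g, cancel f g & cancel g f].

Definition topologically_transitive (T : topologicalType) (f : T -> T) : Prop :=
  forall U V : set T, open U -> open V -> U !=set0 -> V !=set0 ->
  exists n : nat, (iter n f @` U) `&` V !=set0.

Definition birkhoff (R : realType) (S : Type) (T : S -> S) (f : S -> R)
    (n : nat) (x : S) : R := \sum_(k < n) f (iter k T x).

(* A finite partition is given by an indexed family of sets; empty members are
   harmless since 0 * ln 0 = 0. *)
Definition partition_entropy (R : realType) (S : Type) (I : finType)
    (nu : set S -> \bar R) (P : I -> set S) : R :=
  - \sum_(i : I) fine (nu (P i)) * ln (fine (nu (P i))).

(* the join of T^-i P for 0 <= i < n, indexed by the P-itineraries of length n *)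
Definition partition_join (S : Type) (I : finType) (T : S -> S)
    (P : I -> set S) (n : nat) (w : n.-tuple I) : set S :=
  \bigcap_(i in [set: 'I_n]) (iter i T @^-1` P (tnth w i)).

Definition tms_set (A : finType) (M : rel A) :
    set (prod_topology (fun _ : int => discrete_topology A)) :=
  [set x | forall i : int, M (x i) (x (i + 1))].

(* [set_type] carries the topology induced by the product topology. *)
Notation tms M := (set_type (tms_set M)).

Section markov_shift.
Context (A : finType) (M : rel A).
Local Notation Sigma := (tms M).

Definition symb (x : Sigma) (i : int) : A := set_val x i.

Lemma tms_shift_subproof (x : Sigma) :
  (fun i : int => symb x (i + 1)) \in tms_set M.
Proof. by apply/mem_set => i /=; have /set_mem := valP x; exact. Qed.

Definition tms_shift (x : Sigma) : Sigma := SigSub (tms_shift_subproof x).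

(* the distance 2^-m with m the least |i| such that x_i <> y_i; another base
   would give the same Hoelder continuous functions *)
Definition shift_dist (R : realType) (x y : Sigma) : R :=
  inf [set (2 ^- n : R) | n in
    [set n : nat | forall i : int, (`|i| < n)%N -> symb x i = symb y i]].

Definition cylinder (n : nat) (w : n.-tuple A) : set Sigma :=
  [set x | forall i : 'I_n, symb x (i : nat)%:Z = tnth w i].

Definition admissible (n : nat) (w : n.-tuple A) : bool :=
  `[< cylinder w !=set0 >].

Definition pressure (R : realType) (phi : Sigma -> R) : \bar R :=
  limn_esup (fun n : nat =>
    (n%:R^-1 * ln (\sum_(w : n.-tuple A | admissible w)
       expR (sup [set birkhoff tms_shift phi n x | x in cylinder w])))%:E).

(* The past of x is the sequence x_(-1), x_(-2), ...: its j-th entry is the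
   coordinate of index Negz j = - (j + 1). *)
Definition past_seq (x : Sigma) :
    prod_topology (fun _ : nat => discrete_topology A) :=
  fun j : nat => symb x (Negz j).

Definition past_space : Type := set_type (range past_seq).
HB.instance Definition _ := Topological.on past_space.

Lemma past_subproof (x : Sigma) : past_seq x \in range past_seq.
Proof. by apply/mem_set; exists x. Qed.

Definition past (x : Sigma) : past_space := SigSub (past_subproof x).

Lemma symb_continuous (i : int) :
  continuous (symb ^~ i : Sigma -> discrete_topology A).
Proof.
move=> x; apply: (@continuous_comp Sigma
  (prod_topology (fun _ : int => discrete_topology A)) _ set_val (fun y => y i)).
  exact: initial_continuous.
exact: (@proj_continuous _ (fun _ : int => discrete_topology A) i).
Qed.

Lemma past_continuous : continuous past.
Proof.
apply: continuous_comp_initial => x.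
have fx : Filter ((set_val \o past) y @[y --> x]).
  exact: (@fmap_filter _ _ (set_val \o past) (nbhs x) (nbhs_filter x)).
apply/cvg_sup => j.
exact: (@continuous_comp_initial _ Sigma (discrete_topology A)
  (fun y : nat -> A => y j) past_seq (@symb_continuous (Negz j))).
Qed.

Definition base_past (o : Sigma) (x : borel o) : borel (past o) := past x.

Lemma measurable_base_past (o : Sigma) :
  measurable_fun [set: borel o] (@base_past o).
Proof.
exact: (@continuous_measurable_borel _ _ o (past o) past past_continuous).
Qed.

HB.instance Definition _ (o : Sigma) :=
  isMeasurableFun.Build _ _ _ _ (@base_past o) (@measurable_base_past o).

End markov_shift.

Arguments tms_shift {A M} x.
Arguments past {A M} x.
Arguments shift_dist {A M} R x y.
Arguments admissible {A} M {n} w.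

Section skew_product.
Context (R : realType) (A : finType) (M : rel A) (X : metricType R).
Local Notation Sigma := (tms M).
Implicit Types (F : Sigma -> X -> X) (phihat : Sigma * X -> R).

Definition skew F (x : Sigma * X) : Sigma * X := (tms_shift x.1, F x.1 x.2).

(* the distance taken on the space of alpha-Hoelder maps of X *)
Definition unif_dist (f g : X -> X) : R :=
  sup [set mdist (f t) (g t) | t in [set: X]].

Definition skew_dist (x y : Sigma * X) : R :=
  Num.max (shift_dist R x.1 y.1) (mdist x.2 y.2).

Definition has_holonomies F phihat : Prop :=
  exists2 C : R, 0 < C & forall (n : nat) (t : X) (x y : Sigma),
    (forall i : nat, (i <= n)%N -> symb x i%:Z = symb y i%:Z) ->
    `|birkhoff (skew F) phihat n (x, t) - birkhoff (skew F) phihat n (y, t)| <= C.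

Definition depends_on_past F : Prop :=
  forall x y : Sigma, (forall i : int, i <= 0 -> symb x i = symb y i) ->
  F x = F y.

(* A maximizer on [w]; the default value o is only used if there is none, that
   is, if w is not admissible. *)
Definition theta (o : Sigma) F phihat (n : nat) (w : n.-tuple A) (t : X) :
    Sigma :=
  xget o [set x | cylinder w x /\ forall y, cylinder w y ->
    birkhoff (skew F) phihat n (y, t) <= birkhoff (skew F) phihat n (x, t)].

Definition poe (o : Sigma) F phihat : \bar R :=
  limn_esup (fun n : nat => ereal_sup [set
    (n%:R^-1 * ln (\sum_(w : n.-tuple A | admissible M w)
       expR (birkhoff (skew F) phihat n (theta o F phihat w t, t))))%:E
    | t in [set: X]]).

Definition symbol_partition (a : A) : set (Sigma * X) :=
  [set x | symb x.1 0 = a].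

Section measures.
Context (o : Sigma) (x0 : X).
Local Notation SX := (borel ((o, x0) : Sigma * X)).
Local Notation pastX := (borel ((past o, x0) : past_space M * X)).

Definition base_proj (x : SX) : borel o := x.1.

(* The fiber over (w, t) is V^u(w) x {t}, where V^u(w) is the set of points with
   past w. *)
Definition past_fiber_proj (x : SX) : pastX := (past x.1, x.2).

(* The fiber over w is V^u(w) x X. *)
Definition past_proj (x : SX) : borel (past o) := past x.1.

Lemma measurable_base_proj : measurable_fun [set: SX] base_proj.
Proof.
apply: (@continuous_measurable_borel (Sigma * X)%type Sigma (o, x0) o fst).
by move=> x; exact: cvg_fst.
Qed.

Lemma past_fst_continuous : continuous (fun x : Sigma * X => past x.1).
Proof.
move=> x; apply: (@continuous_comp _ _ _ fst past x).
  exact: cvg_fst.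
exact: past_continuous.
Qed.

Lemma measurable_past_fiber_proj : measurable_fun [set: SX] past_fiber_proj.
Proof.
apply: (@continuous_measurable_borel (Sigma * X)%type (past_space M * X)%type
  (o, x0) (past o, x0) (fun x => (past x.1, x.2))) => x.
exact: (@cvg_pair _ _ _ (nbhs x) (nbhs (past x.1)) (nbhs x.2)
  (nbhs_filter x) (nbhs_filter _) (nbhs_filter _) _ _
  (@past_fst_continuous x) (@cvg_snd _ _ _ _ _)).
Qed.

Lemma measurable_past_proj : measurable_fun [set: SX] past_proj.
Proof.
exact: (@continuous_measurable_borel (Sigma * X)%type (past_space M)
  (o, x0) (past o) _ past_fst_continuous).
Qed.

HB.instance Definition _ :=
  isMeasurableFun.Build _ _ _ _ base_proj measurable_base_proj.
HB.instance Definition _ :=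
  isMeasurableFun.Build _ _ _ _ past_fiber_proj measurable_past_fiber_proj.
HB.instance Definition _ :=
  isMeasurableFun.Build _ _ _ _ past_proj measurable_past_proj.

Definition skew_invariant F (mu : probability SX R) : Prop :=
  forall B : set SX, measurable B -> mu (skew F @^-1` B) = mu B.

(* Disintegrations of Borel probabilities exist on these compact metric spaces
   and are unique up to null sets, so the set below is a singleton and the default
   value -oo is not used. *)
Definition entropy_ooe F (mu : probability SX R) : \bar R :=
  xget -oo%E [set h | exists2 kappa : R.-pker pastX ~> SX,
    is_disintegration mu past_fiber_proj kappa &
    h = limn_esup (fun n : nat => \int[distribution mu past_fiber_proj]_q
      (n%:R^-1 * partition_entropy (kappa q)
        (@partition_join _ _ (skew F) symbol_partition n))%:E)%E].

Definition free_energy F phihat (mu : probability SX R) : \bar R :=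
  (entropy_ooe F mu + \int[mu]_x (phihat x)%:E)%E.

Definition attains_max F phihat (mu : probability SX R) : Prop :=
  skew_invariant F mu /\
  forall nu : probability SX R, skew_invariant F nu ->
    (free_energy F phihat nu <= free_energy F phihat mu)%E.

(* Since disintegrations exist and are a.e. unique, quantifying over all of them
   amounts to fixing one of each. *)
Definition future_independent (mu : probability SX R) : Prop :=
  let eta := distribution mu base_proj in
  let eta_past := distribution eta (@base_past A M o) in
  forall (kappahat : R.-pker (borel (past o)) ~> SX)
    (kappa : R.-pker (borel (past o)) ~> (borel o)),
  is_disintegration mu past_proj kappahat ->
  is_disintegration eta (@base_past A M o) kappa ->
  {ae eta_past, forall w, exists sigma : probability (borel x0) R,
    forall B : set SX, measurable B -> kappahat w B = (kappa w \x sigma)%E B}.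

End measures.
End skew_product.

(* Main.v *)
(* If [phihat] does not depend on the fiber coordinate, neither do the
   maximizers [theta], and the two pressures agree termwise.

   For the second part, let [p (w, t) = (past of w, t)]. As [F_w] depends only on
   the coordinates [w_i], [i <= 0], the value of [p] at [skew F x] is a function
   of [p x] and of the symbol [x_0], and [p x] is a function of [p (skew F x)].
   For an invariant measure the conditional measures on the fibers of [p]
   therefore obey a chain rule, whence their integrated entropies on the n-th
   join are exactly [n] times those on the time-zero partition.

   Let [mu] be maximal with base marginal [eta], and average the images of
   [eta] under the maps [w |-> skew^k (w, x0)] over [k]. The averages converge
   along an ultrafilter to a finitely additive content, whose regularization
   [nu] is an invariant Borel probability with base marginal [eta]. Its
   conditional measures on the fibers of [p] are [eta_w (x) delta_t], because
   the X-coordinate of [skew^k (w, x0)] depends only on the past of the k-th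
   shift of [w]. Now [nu] and [mu] have the same integral of [phihat], hence
   maximality gives an integrated conditional entropy of [mu] at least that of
   [nu] on every join. By the equality case of Gibbs' inequality, the
   conditional measure of [mu] at [(w, t)] projects to [eta_w], for a.e. [(w,
   t)]: given the past, the future is independent of [t]. *)
From HB Require Import structures.
Require Import Defs.
From mathcomp Require Import all_boot all_order all_algebra.
From mathcomp Require Import all_classical all_reals all_analysis measurable_realfun.
From mathcomp Require Import ring lra.
Set Implicit Arguments.
Unset Strict Implicit.
Unset Printing Implicit Defensive.
Import Order.TTheory GRing.Theory Num.Theory.
Import numFieldTopology.Exports numFieldNormedType.Exports.
Local Open Scope classical_set_scope.
Local Open Scope ring_scope.

(** * Disintegrations *)

(** The obstacle is that the limiting content is only finitely additive, so it has no conditional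
    measures from which those of [nu] could be read. What is carried through the construction
    instead is a family of one-sided bounds: if [kappa q C >= r] for all pasts [q] in [P], then the
    points with past in [P], base point in [C] and fiber coordinate in [E] have at least [r] times
    the mass of the points with past in [P] and fiber coordinate in [E]. Such bounds survive
    averages, ultrafilter limits and suprema over closed sets. They are integrated only once [nu] is
    a measure, and the bound for the complement of [C] then forces equality. Two further points
    shape the text. Existence of disintegrations is never proved in general: that of [nu] is written
    down from [kappa], and that of [mu] exists because the entropy of [mu], being at least that of
    [nu], is not the default [-oo]. The cross entropy in Gibbs' inequality may be infinite a priori,
    so the argument adds nonnegative functions where one would like to subtract integrals. *)

Section pker_probability.
Context d d' (S : measurableType d) (Q : measurableType d') (R : realType).
Variables (kappa : R.-pker Q ~> S) (q : Q).

(** The values of a kernel are typed as measures. Repackaged as a probability, [kappa q] admits the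
    lemmas on complements and bounds, and [distribution]. *)
Definition pker_at : set S -> \bar R := kappa q.

HB.instance Definition _ := Measure.on pker_at.

HB.instance Definition _ :=
  Measure_isProbability.Build _ _ _ pker_at (prob_kernel q).

Definition pker_prob : probability S R := pker_at.

End pker_probability.

Section pker_comp.
Context d d' d'' (S : measurableType d) (Q : measurableType d')
  (Q' : measurableType d'') (R : realType).
Variables (kappa : R.-pker Q ~> S) (f : Q' -> Q) (mf : measurable_fun setT f).

(** The measurability proof is an argument of the definition so that the kernel structure can be
    attached to the term. *)
Definition pker_comp & measurable_fun setT f : Q' -> {measure set S -> \bar R} :=
  kappa \o f.

Let measurable_pker_comp U : measurable U ->
  measurable_fun setT (pker_comp mf ^~ U).
Proof.
by move=> mU; exact: measurableT_comp (measurable_kernel kappa U mU) mf.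
Qed.

HB.instance Definition _ :=
  isKernel.Build _ _ _ _ R (pker_comp mf) measurable_pker_comp.

Let pker_comp_setT q : pker_comp mf q setT = 1%E.
Proof. exact: prob_kernel. Qed.

HB.instance Definition _ :=
  Kernel_isProbability.Build _ _ _ _ R (pker_comp mf) pker_comp_setT.

End pker_comp.

Section mixture.
Local Open Scope ereal_scope.
Context d d' (S : measurableType d) (Q : measurableType d') (R : realType).
Variables (tau : probability Q R) (kappa : R.-pker Q ~> S).

Let unit_kernel (_ : unit) : {measure set Q -> \bar R} := tau.

Let measurable_unit_kernel U : measurable U ->
  measurable_fun [set: unit] (unit_kernel ^~ U).
Proof. by []. Qed.

HB.instance Definition _ :=
  isKernel.Build _ _ _ _ R unit_kernel measurable_unit_kernel.

Let unit_kernel_setT x : unit_kernel x [set: Q] = 1.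
Proof. exact: probability_setT. Qed.

HB.instance Definition _ :=
  Kernel_isProbability.Build _ _ _ _ R unit_kernel unit_kernel_setT.

Let measurable_snd_unit : measurable_fun setT (snd : unit * Q -> Q).
Proof. exact: measurable_snd. Qed.

Let snd_kernel : R.-pker (unit * Q) ~> S := pker_comp kappa measurable_snd_unit.

(** Written as a composition of kernels issued from the one-point space: countable additivity and
    the iterated integral formula are then those of kernel composition. *)
Definition mixture : {measure set S -> \bar R} :=
  mkcomp unit_kernel snd_kernel tt.

Lemma mixtureE B : mixture B = \int[tau]_q kappa q B.
Proof. by []. Qed.

Lemma integral_mixture (f : S -> \bar R) : measurable_fun setT f ->
  (forall x, 0 <= f x) ->
  \int[mixture]_x f x = \int[tau]_q \int[kappa q]_x f x.
Proof.
by move=> mf f0; exact: (@integral_kcomp _ _ _ _ _ _ _ unit_kernel snd_kernel tt f f0 mf).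
Qed.

End mixture.

Section disintegration_integral.
Local Open Scope ereal_scope.
Context d d' (S : measurableType d) (Q : measurableType d') (R : realType).
Variables (mu : probability S R) (p : {mfun S >-> Q}) (kappa : R.-pker Q ~> S).
Let tau := distribution mu p.
Hypothesis kmu : is_disintegration mu p kappa.

Lemma disintegration_integral (f : S -> \bar R) : measurable_fun setT f ->
  (forall x, 0 <= f x) ->
  \int[mu]_x f x = \int[tau]_q \int[kappa q]_x f x.
Proof.
move=> mf f0; rewrite -integral_mixture//.
by apply: eq_measure_integral => B mB _; exact: (proj1 kmu _ mB).
Qed.

End disintegration_integral.

Section disintegration.
Local Open Scope ereal_scope.
Context d d' (S : measurableType d) (Q : measurableType d') (R : realType).
Variables (mu : probability S R) (p : {mfun S >-> Q}) (kappa : R.-pker Q ~> S).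
Let tau := distribution mu p.
Hypothesis kmu : is_disintegration mu p kappa.
Hypothesis mQ1 : forall q : Q, measurable [set q].

(** A measure carried by a single fiber gives mass 0 or 1 to a preimage under [p]. The exceptional
    set comes from the concentration clause alone, so one null set serves all [C] and [D];
    [conditional_product] relies on this order of quantifiers. *)
Lemma disintegration_fiberI : {ae tau, forall q, forall C D, measurable C ->
  measurable D -> kappa q (C `&` p @^-1` D) = kappa q C * (\1_D q)%:E}.
Proof.
case: kmu => _; apply: filterS => q kq C D mC mD.
have mp E : measurable E -> measurable (p @^-1` E).
  by move=> mE; rewrite -[_ @^-1` _]setTI; exact: measurable_funP.
have null E : measurable E -> ~ E q -> kappa q (p @^-1` E) = 0.
  move=> mE Eq.
  suff : kappa q (p @^-1` E) <= kappa q (~` (p @^-1` [set q])).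
    rewrite [leRHS](probability_setC (pker_prob kappa q)); last exact: mp.
    by rewrite kq subee// => h; apply/eqP; rewrite eq_le h/=.
  apply: le_measure; rewrite ?inE; [exact: mp|exact/measurableC/mp|].
  by move=> x /= Ex px; apply: Eq; rewrite -px.
have null' E : measurable E -> ~ E q -> kappa q (C `&` p @^-1` E) = 0.
  move=> mE Eq; apply/eqP; rewrite eq_le measure_ge0 andbT -(null E mE Eq).
  apply: le_measure; rewrite ?inE; [|exact: mp|exact: subIsetr].
  by apply: measurableI => //; exact: mp.
rewrite indicE; have [Dq|Dq] := boolP (q \in D); last first.
  by rewrite mule0 null'//; move: Dq; rewrite notin_setE.
rewrite mule1 [RHS](measureDI _ mC (mp _ mD)) setDE preimage_setC.
rewrite -[LHS]add0e; congr (_ + _); apply/esym/null'.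
  exact: measurableC.
by rewrite inE in Dq; exact.
Qed.

Lemma disintegration_setI C D : measurable C -> measurable D ->
  mu (C `&` p @^-1` D) = \int[tau]_(q in D) kappa q C.
Proof.
move=> mC mD.
have mp : measurable (p @^-1` D).
  by rewrite -[_ @^-1` _]setTI; exact: measurable_funP.
have mCD : measurable (C `&` p @^-1` D) by exact: measurableI.
rewrite [LHS](proj1 kmu _ mCD).
rewrite [RHS]integral_mkcond.
apply: ae_eq_integral => //.
- by apply: measurable_kernel; exact: measurableI.
- apply/(measurable_restrictT _ _).1 => //.
  by apply: measurable_funTS; exact: measurable_kernel.
move: disintegration_fiberI; apply: filterS => q /(_ C D mC mD) + _ => ->.
by rewrite epatch_indic.
Qed.

(** The pull-out rule of conditional expectations: [h (p x)] is constant, equal to [h q], on the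
    fiber that carries [kappa q]. *)
Lemma disintegration_integral_setI C (h : Q -> \bar R) : measurable C ->
  measurable_fun setT h -> (forall q, 0 <= h q) ->
  \int[mu]_(x in C) h (p x) = \int[tau]_q (h q * kappa q C).
Proof.
move=> mC mh h0.
have mhp : measurable_fun setT (fun x => h (p x)) by exact: measurableT_comp.
rewrite integral_mkcond (disintegration_integral kmu)//; last 2 first.
- by apply/(measurable_restrictT _ _).1 => //; exact: measurable_funTS.
- by move=> x; rewrite erestrict_ge0.
apply: ae_eq_integral => //.
- apply: (@measurable_fun_integral_kernel _ _ _ _ R kappa).
  + exact: measurable_kernel.
  + by move=> x; rewrite erestrict_ge0.
  + by apply/(measurable_restrictT _ _).1 => //; exact: measurable_funTS.
- by apply: emeasurable_funM => //; exact: measurable_kernel.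
move: disintegration_fiberI; apply: filterS => q fq _.
rewrite -integral_mkcond -integral_cst//.
rewrite [LHS]integral_mkcond [RHS]integral_mkcond.
have mp1 : measurable (p @^-1` [set q]).
  by rewrite -[_ @^-1` _]setTI; exact: measurable_funP.
apply: ae_eq_integral => //.
- by apply/(measurable_restrictT _ _).1 => //; exact: measurable_funTS.
- by apply/(measurable_restrictT _ _).1 => //; exact: measurable_funTS.
exists (~` (p @^-1` [set q])); split.
- exact: measurableC.
- have := fq setT [set q] measurableT (mQ1 q).
  rewrite setTI indicE mem_set// mule1 => kq.
  by rewrite [LHS](probability_setC (pker_prob kappa q))// kq prob_kernel subee.
- move=> x /= xq pxq; apply: xq => _; rewrite /patch.
  by case: ifPn => // _; congr h; apply: pxq.
Qed.

End disintegration.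

Lemma pker_fin_num d d' (S : measurableType d) (Q : measurableType d')
    (R : realType) (kappa : R.-pker Q ~> S) q C : measurable C ->
  (kappa q C \is a fin_num)%E.
Proof. exact: (fin_num_measure (pker_prob kappa q)). Qed.

Lemma pker_le1 d d' (S : measurableType d) (Q : measurableType d')
    (R : realType) (kappa : R.-pker Q ~> S) q C : measurable C ->
  (kappa q C <= 1)%E.
Proof. exact: (probability_le1 (pker_prob kappa q)). Qed.

Lemma pker_fine_bounds d d' (S : measurableType d) (Q : measurableType d')
    (R : realType) (kappa : R.-pker Q ~> S) q C : measurable C ->
  0 <= fine (kappa q C) <= 1.
Proof.
move=> mC; rewrite fine_ge0//= -lee_fin fineK; first exact: pker_le1.
exact: pker_fin_num.
Qed.

Section disintegration_unique.
Local Open Scope ereal_scope.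
Context d d' (S : measurableType d) (Q : measurableType d') (R : realType).
Variables (mu : probability S R) (p : {mfun S >-> Q}) (kappa : R.-pker Q ~> S).
Let tau := distribution mu p.
Hypothesis kmu : is_disintegration mu p kappa.
Hypothesis mQ1 : forall q : Q, measurable [set q].

(** Uniqueness of a Radon-Nikodym density. It is stated for one set [C] at a time, so each use costs
    one null set and asks for no countable generator. *)
Lemma disintegration_ae_eq C (f : Q -> \bar R) : measurable C ->
  measurable_fun setT f -> (forall q, 0 <= f q) ->
  (forall D, measurable D -> \int[tau]_(q in D) f q = mu (C `&` p @^-1` D)) ->
  {ae tau, forall q, f q = kappa q C}.
Proof.
move=> mC mf f0 fC.
have : ae_eq tau setT f (kappa ^~ C).
  apply: integral_ae_eq => //.
  - apply/integrableP; split => //.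
    under eq_integral do rewrite gee0_abs//.
    rewrite fC// preimage_setT setIT.
    by rewrite (le_lt_trans (probability_le1 _ _))// ltry.
  - exact: (measurable_kernel kappa C mC).
  - by move=> E _ mE; rewrite fC// (disintegration_setI kmu mQ1).
by apply: filterS => q; exact.
Qed.

End disintegration_unique.

(** * Chain rule for conditional entropies *)

Section mulr_ln.
Variable R : realType.
Implicit Types x y : R.

(** One term of the chain rule. Where an argument vanishes, [lnM] fails for the convention
    [ln 0 = 0], but the prefactor absorbs this. *)
Lemma mulr_ln_mul x y : 0 <= x -> 0 <= y ->
  x * y * ln (x * y) = y * (x * ln x) + x * (y * ln y).
Proof.
rewrite le0r => /orP[/eqP ->|x0]; first by rewrite !mul0r mulr0 addr0.
rewrite le0r => /orP[/eqP ->|y0]; first by rewrite !mul0r !mulr0 mul0r addr0.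
by rewrite lnM ?posrE//; ring.
Qed.

Lemma mulr_ln_le0 x : 0 <= x <= 1 -> x * ln x <= 0.
Proof. by move=> /andP[x0 x1]; rewrite mulr_ge0_le0// ln_le0. Qed.

End mulr_ln.

Lemma sum_tupleS (V : nmodType) (I : finType) n (f : n.+1.-tuple I -> V) :
  \sum_(w : n.+1.-tuple I) f w =
  \sum_(a : I) \sum_(w : n.-tuple I) f [tuple of a :: w].
Proof.
rewrite pair_big /= (reindex (fun aw : I * n.-tuple I => [tuple of aw.1 :: aw.2])) //=.
exists (fun w : n.+1.-tuple I => (thead w, [tuple of behead w])) => [[a w] _|w _] /=.
  by congr pair; apply: val_inj.
by rewrite [RHS]tuple_eta.
Qed.

Section fibers.
Local Open Scope ereal_scope.
Context d (S : measurableType d) (R : realType) (J : finType).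
Variables (m : {measure set S -> \bar R}) (l : S -> J).
Hypothesis ml : forall j, measurable [set x | l x = j].

Lemma integral_fibers (f : S -> \bar R) : measurable_fun setT f ->
  (forall x, 0 <= f x) ->
  \int[m]_x f x = \sum_(j : J) \int[m]_(x in [set x | l x = j]) f x.
Proof.
move=> mf f0; under [RHS]eq_bigr do rewrite integral_mkcond.
rewrite -ge0_integral_sum//; last 2 first.
- by move=> j; apply/(measurable_restrictT _ _).1 => //; exact: measurable_funTS.
- by move=> j x _; rewrite erestrict_ge0.
apply: eq_integral => x _; rewrite (bigD1 (l x))//= big1.
  by rewrite adde0 /patch mem_set.
by move=> j /eqP jl; rewrite /patch memNset// => /esym.
Qed.

Lemma measure_fibers : m setT = \sum_(j : J) m [set x | l x = j].
Proof.
rewrite -[LHS]mul1e -integral_cst// integral_fibers//.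
by apply: eq_bigr => j _; rewrite integral_cst// mul1e.
Qed.

End fibers.

Lemma pker_sum_fibers d d' (S : measurableType d) (Q : measurableType d')
    (R : realType) (kappa : R.-pker Q ~> S) (J : finType) (l : S -> J) q :
  (forall j, measurable [set x | l x = j]) ->
  \sum_(j : J) fine (kappa q [set x | l x = j]) = 1.
Proof.
move=> ml; apply: EFin_inj.
rewrite -sumEFin -[RHS](prob_kernel (s := kappa) q) (measure_fibers _ ml).
by apply: eq_bigr => j _; rewrite fineK//; exact: pker_fin_num.
Qed.

Section entropy_chain_rule.
Local Open Scope ereal_scope.
Context d d' (S : measurableType d) (Q : measurableType d') (R : realType).
Context (I : finType).
Variables (mu : probability S R) (p : {mfun S >-> Q}) (kappa : R.-pker Q ~> S).
Let tau := distribution mu p.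
Hypothesis kmu : is_disintegration mu p kappa.
Hypothesis mQ1 : forall q : Q, measurable [set q].
Variable T : S -> S.
Hypothesis mT : measurable_fun setT T.
Hypothesis muT : forall B, measurable B -> mu (T @^-1` B) = mu B.
Variable sym : S -> I.
Let P a := [set x | sym x = a].
Hypothesis mP : forall a, measurable (P a).
Variable s : I -> Q -> Q.
Hypothesis ms : forall a, measurable_fun setT (s a).
Hypothesis pT : forall x, p (T x) = s (sym x) (p x).
Hypothesis preimageT : forall a D, measurable D ->
  exists2 D', measurable D' & P a `&` p @^-1` D = T @^-1` (p @^-1` D').

Lemma integral_invariant B (f : S -> \bar R) : measurable B ->
  measurable_fun setT f -> (forall x, 0 <= f x) ->
  \int[mu]_(x in T @^-1` B) f (T x) = \int[mu]_(x in B) f x.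
Proof.
move=> mB mf f0.
have mfB : measurable_fun B f by exact: measurable_funTS.
rewrite -(ge0_integral_pushforward mT mu mB mfB); last by [].
by apply: eq_measure_integral => A mA _; exact: muT.
Qed.

Let mTpre B : measurable B -> measurable (T @^-1` B).
Proof. by move=> mB; rewrite -[_ @^-1` _]setTI; exact: mT. Qed.

Let mppre B : measurable B -> measurable (p @^-1` B).
Proof. by move=> mB; rewrite -[_ @^-1` _]setTI; exact: measurable_funP. Qed.

(** To know [q] and the symbol [a] is to know the [p]-fiber of the image point. By [preimageT] the
    event that the symbol is [a] and [p x] lies in [D] is the preimage under [T] of an event of the
    form [p x] in [D'], so invariance carries the defining identity of [kappa] at [D'] back to
    [D]. *)
Lemma disintegration_step a C : measurable C ->
  {ae tau, forall q,
    kappa q (P a) * kappa (s a q) C = kappa q (P a `&` T @^-1` C)}.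
Proof.
move=> mC; have mPC : measurable (P a `&` T @^-1` C).
  by apply: measurableI => //; exact: mTpre.
have mk := measurable_kernel kappa.
have mksa : measurable_fun setT (fun q => kappa (s a q) C).
  exact: measurableT_comp (mk _ mC) (ms a).
apply: (disintegration_ae_eq kmu) => //.
  by apply: emeasurable_funM => //; exact: mk.
move=> D mD; have [D' mD' PDD'] := preimageT a mD.
transitivity (\int[tau]_q (((fun q => kappa (s a q) C) \_ D) q * kappa q (P a))).
  rewrite integral_mkcond; apply: eq_integral => q _.
  by rewrite /patch; case: ifPn => _; rewrite ?mul0e// muleC.
rewrite -(disintegration_integral_setI kmu)//; last 2 first.
- by apply/(measurable_restrictT _ _).1 => //; exact: measurable_funTS.
- by move=> q; rewrite erestrict_ge0.
transitivity (\int[mu]_(x in P a `&` p @^-1` D) kappa (s a (p x)) C).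
  rewrite [RHS]integral_mkcondr; apply: eq_integral => x _; rewrite /patch.
  by have -> : (x \in p @^-1` D) = (p x \in D) by apply/idP/idP; rewrite !inE.
(* On [P a] the point [s a (p x)] is [p (T x)]: the integrand becomes a function of [T x], to which
   invariance applies. *)
transitivity (\int[mu]_(x in T @^-1` (p @^-1` D')) kappa (p (T x)) C).
  by rewrite -PDD'; apply: eq_integral => x; rewrite inE pT => -[->].
rewrite (integral_invariant (f := fun y => kappa (p y) C)); last 3 first.
- exact: mppre.
- exact: measurableT_comp (mk _ mC) (measurable_funPT p).
- by [].
have mkC : measurable_fun D' (fun q => kappa q C).
  exact: measurable_funTS (mk _ mC).
rewrite -(ge0_integral_pushforward (measurable_funPT p) mu mD' mkC); last by [].
rewrite -[LHS](disintegration_setI kmu)// -muT; last first.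
  by apply: measurableI => //; exact: mppre.
by rewrite preimage_setI -PDD' setICA setIA.
Qed.

Lemma partition_joinS n a (w : n.-tuple I) :
  partition_join T P [tuple of a :: w] = P a `&` T @^-1` partition_join T P w.
Proof.
apply/seteqP; split => x.
  move=> h; split; first by have := h ord0 Logic.I; rewrite /= tnth0.
  by move=> i _; have := h (lift ord0 i) Logic.I; rewrite /= tnthS -iterSr.
move=> [xa h] i _; case: (unliftP ord0 i) => [j|] ->; last by rewrite /= tnth0.
by rewrite /= tnthS -iterS iterSr; exact: h.
Qed.

Lemma partition_join0 (w : 0.-tuple I) : partition_join T P w = setT.
Proof. by apply/seteqP; split => // x _ []. Qed.

Lemma measurable_partition_join n (w : n.-tuple I) :
  measurable (partition_join T P w).
Proof.
elim: n w => [w|n IH w]; first by rewrite partition_join0.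
rewrite (tuple_eta w) partition_joinS; apply: measurableI => //.
exact/mTpre/IH.
Qed.

Let H n q : R := partition_entropy (kappa q) (@partition_join _ _ T P n).

Lemma sum_partition_join n q :
  (\sum_(w : n.-tuple I) fine (kappa q (partition_join T P w)) = 1)%R.
Proof.
pose l x := [tuple sym (iter i T x) | i < n].
have lE w : [set x | l x = w] = partition_join T P w.
  apply/seteqP; split => x.
    by move=> /= <- i _; rewrite /= tnth_mktuple.
  move=> h; apply: eq_from_tnth => i; rewrite tnth_mktuple.
  exact: (h i Logic.I).
have ml w : measurable [set x | l x = w].
  by rewrite lE; exact: measurable_partition_join.
by rewrite -[RHS](pker_sum_fibers kappa q ml); apply: eq_bigr => w _; rewrite lE.
Qed.

Lemma partition_entropy_ge0 (J : finType) (C : J -> set S) q :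
  (forall j, measurable (C j)) -> (0 <= partition_entropy (kappa q) C)%R.
Proof.
move=> mC; rewrite /partition_entropy oppr_ge0 sumr_le0// => j _.
by rewrite mulr_ln_le0// pker_fine_bounds.
Qed.

Lemma measurable_partition_entropy (J : finType) (C : J -> set S) :
  (forall j, measurable (C j)) ->
  measurable_fun setT (fun q => partition_entropy (kappa q) C).
Proof.
move=> mC; apply: measurable_funN; apply: measurable_sum => j.
have mf : measurable_fun setT (fun q => fine (kappa q (C j))).
  by apply: measurableT_comp => //; exact: (measurable_kernel kappa _ (mC j)).
by apply: measurable_funM => //; exact: measurableT_comp.
Qed.

(** The first symbol is split off: masses of words factor by [disintegration_step], and in the part
    carrying the logarithm of the first factor the others sum to 1. *)
Lemma partition_entropyS n : {ae tau, forall q,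
  H n.+1 q = (partition_entropy (kappa q) P +
              \sum_(a : I) fine (kappa q (P a)) * H n (s a q))%R}.
Proof.
have : {ae tau, forall q, forall aw : I * n.-tuple I,
    kappa q (P aw.1) * kappa (s aw.1 q) (partition_join T P aw.2) =
    kappa q (partition_join T P [tuple of aw.1 :: aw.2])}.
  apply: filter_forall => -[a w]; rewrite partition_joinS.
  by apply: disintegration_step; exact: measurable_partition_join.
apply: filterS => q kq; rewrite /H /partition_entropy sum_tupleS.
rewrite -[RHS]opprK opprD; congr (- _)%R.
under [X in _ = (_ - X)%R]eq_bigr do rewrite mulrN.
rewrite sumrN !opprK -big_split; apply: eq_bigr => a _ /=.
pose x := fine (kappa q (P a)).
pose y (w : n.-tuple I) := fine (kappa (s a q) (partition_join T P w)).
transitivity (\sum_(w : n.-tuple I) (y w * (x * ln x) + x * (y w * ln (y w))))%R.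
  apply: eq_bigr => w _; rewrite -(kq (a, w)) fineM/=.
  - by rewrite mulr_ln_mul ?fine_ge0.
  - exact: pker_fin_num.
  - by apply: pker_fin_num; exact: measurable_partition_join.
by rewrite big_split/= -mulr_suml sum_partition_join mul1r mulr_sumr.
Qed.

(** Weighted by [kappa q (P a)], the values [H n (s a q)] average [H n (p (T x))] over the fiber,
    and invariance of [mu] then removes [T]. *)
Lemma integral_partition_entropyS n :
  \int[tau]_q (H n.+1 q)%:E =
  \int[tau]_q (partition_entropy (kappa q) P)%:E + \int[tau]_q (H n q)%:E.
Proof.
have mH m : measurable_fun setT (fun q => (H m q)%:E).
  apply/measurable_EFinP/measurable_partition_entropy => w.
  exact: measurable_partition_join.
have mHs a : measurable_fun setT (fun q => (H n (s a q))%:E).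
  exact: measurableT_comp (mH n) (ms a).
have H0 m q : 0 <= (H m q)%:E.
  rewrite lee_fin; apply: partition_entropy_ge0 => w.
  exact: measurable_partition_join.
have mHP : measurable_fun setT (fun q => (partition_entropy (kappa q) P)%:E).
  exact/measurable_EFinP/measurable_partition_entropy.
have mk := measurable_kernel kappa.
have msum a : measurable_fun setT (fun q => (H n (s a q))%:E * kappa q (P a)).
  by apply: emeasurable_funM => //; exact: mk.
transitivity (\int[tau]_q ((partition_entropy (kappa q) P)%:E +
    \sum_(a : I) (H n (s a q))%:E * kappa q (P a))).
  apply: ae_eq_integral => //.
    by apply: emeasurable_funD => //; exact: emeasurable_sum.
  move: (partition_entropyS n); apply: filterS => q -> _.
  rewrite EFinD -sumEFin; congr (_ + _); apply: eq_bigr => a _.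
  rewrite EFinM fineK; first exact: muleC.
  exact: pker_fin_num.
have P0 q : setT q -> 0 <= (partition_entropy (kappa q) P)%:E.
  by move=> _; rewrite lee_fin; exact: partition_entropy_ge0.
have sum0 q : setT q -> 0 <= \sum_(a : I) (H n (s a q))%:E * kappa q (P a).
  by move=> _; apply: sume_ge0 => a _; apply: mule_ge0.
have msumA : measurable_fun setT
    (fun q => \sum_(a : I) (H n (s a q))%:E * kappa q (P a)).
  exact: emeasurable_sum.
rewrite (ge0_integralD tau measurableT P0 mHP sum0 msumA); congr (_ + _).
rewrite ge0_integral_sum//; last first.
  by move=> a q _; apply: mule_ge0.
transitivity (\sum_(a : I) \int[mu]_(x in P a) (H n (p (T x)))%:E).
  apply: eq_bigr => a _; rewrite -(disintegration_integral_setI kmu)//.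
  by apply: eq_integral => x; rewrite inE pT => ->.
have mHp : measurable_fun setT (fun x => (H n (p x))%:E).
  exact: measurableT_comp (mH n) (measurable_funPT p).
rewrite -(@integral_fibers _ _ _ _ mu sym mP (fun x => (H n (p (T x)))%:E))//; last first.
  exact: measurableT_comp mHp mT.
rewrite -(preimage_setT T) (@integral_invariant setT (fun x => (H n (p x))%:E))//.
exact: (esym (ge0_integral_distribution (P := mu) p (mH n) (H0 n))).
Qed.

Lemma integral_partition_entropy n :
  \int[tau]_q (H n q)%:E =
  n%:R%:E * \int[tau]_q (partition_entropy (kappa q) P)%:E.
Proof.
elim: n => [|n IH].
  rewrite mul0e integral0_eq// => q _; rewrite /H /partition_entropy.
  rewrite big1 ?oppr0// => w _; rewrite partition_join0 prob_kernel.
  by rewrite /= ln1 mulr0.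
rewrite integral_partition_entropyS IH -natr1 EFinD ge0_muleDl ?lee_fin//.
by rewrite mul1e addeC.
Qed.

End entropy_chain_rule.

(** * Equality in Gibbs' inequality *)

(** For positive [g] this is [g] times the strict tangent inequality of [expR] at 0, evaluated at
    [ln (k / g)]. The condition [k = 0 -> g = 0] guards against the convention [ln 0 = 0]; the
    linear part [k - g] cancels when both families sum to 1. *)
Lemma gibbs_term (R : realType) (g k : R) : 0 <= g -> 0 <= k ->
  (k = 0 -> g = 0) -> 0 <= g * ln g - g * ln k - g + k ?= iff (g == k).
Proof.
move=> g0 k0 kg; apply/leifP; case: eqVneq => [->|gk]; first by lra.
have [g00|gN0] := eqVneq g 0.
  by rewrite g00 !mul0r !subr0 add0r lt_neqAle eq_sym -g00 eq_sym gk g00.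
have gp : 0 < g by rewrite lt_neqAle eq_sym gN0.
have kp : 0 < k by rewrite lt_neqAle k0 andbT eq_sym; apply: contra_neq gN0.
have kg1 : k / g != 1 by apply: contra_neq gk => /divr1_eq.
have l0 : ln (k / g) != 0 by rewrite ln_eq0 ?divr_gt0.
have := expR_gt1Dx l0; rewrite lnK ?posrE ?divr_gt0//.
rewrite ln_div ?posrE// ltr_pdivlMr// => h.
by rewrite -subr_gt0 in h; move: h; congr (_ < _); ring.
Qed.

(** The case [k = 1] of [gibbs_term]; it makes entropies over a finite index set bounded. *)
Lemma oppr_mulr_ln_le1 (R : realType) (x : R) : 0 <= x -> - (x * ln x) <= 1 - x.
Proof.
move=> x0; have h : 1 = 0 :> R -> x = 0 by move/eqP; rewrite oner_eq0.
have [+ _] := gibbs_term x0 ler01 h.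
rewrite ln1; lra.
Qed.

Section gibbs.
Local Open Scope ereal_scope.
Context d (Q : measurableType d) (R : realType) (J : finType).
Variables (tau : probability Q R) (g k : J -> Q -> R).
Hypothesis mg : forall j, measurable_fun setT (g j).
Hypothesis mk : forall j, measurable_fun setT (k j).
Hypothesis g0 : forall j q, (0 <= g j q <= 1)%R.
Hypothesis k0 : forall j q, (0 <= k j q <= 1)%R.
Hypothesis g1 : forall q, (\sum_j g j q = 1)%R.
Hypothesis k1 : forall q, (\sum_j k j q = 1)%R.
(* For [h = - ln] this says that the cross entropy of [g] and [k] is the entropy
   of [k]; the integrals may be infinite a priori. *)
Hypothesis gk : forall j (h : R -> R), measurable_fun setT h ->
  (forall x, (0 <= x <= 1)%R -> (0 <= h x)%R) ->
  \int[tau]_q (h (k j q) * g j q)%:E = \int[tau]_q (h (k j q) * k j q)%:E.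
Hypothesis entropy_le :
  \int[tau]_q (- \sum_j k j q * ln (k j q))%:E <=
  \int[tau]_q (- \sum_j g j q * ln (g j q))%:E.

(** [U] and [W] are the entropies of [g] and [k], and [V] is their cross entropy. The divergence
    [V - U] is almost everywhere a sum of nonnegative terms, while [gk] and [entropy_le] leave no
    room for a positive integral. *)
Lemma gibbs_eq : {ae tau, forall q, forall j, g j q = k j q}.
Proof.
have mlnk j : measurable_fun setT (fun q => ln (k j q)).
  exact: measurableT_comp (mk j).
have mlng j : measurable_fun setT (fun q => ln (g j q)).
  exact: measurableT_comp (mg j).
have lnk0 j q : (0 <= - ln (k j q))%R.
  by rewrite oppr_ge0 ln_le0//; case/andP: (k0 j q).
have lng0 j q : (0 <= - ln (g j q))%R.
  by rewrite oppr_ge0 ln_le0//; case/andP: (g0 j q).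
have g00 j q : (0 <= g j q)%R by case/andP: (g0 j q).
have k00 j q : (0 <= k j q)%R by case/andP: (k0 j q).
pose U q := (\sum_j - ln (g j q) * g j q)%R.
pose V q := (\sum_j - ln (k j q) * g j q)%R.
pose W q := (\sum_j - ln (k j q) * k j q)%R.
have mU : measurable_fun setT U.
  apply: measurable_sum => j; apply: measurable_funM => //.
  exact: measurable_funN.
have mV : measurable_fun setT V.
  apply: measurable_sum => j; apply: measurable_funM => //.
  exact: measurable_funN.
have U0 q : (0 <= U q)%R by apply: sumr_ge0 => j _; rewrite mulr_ge0.
have V0 q : (0 <= V q)%R by apply: sumr_ge0 => j _; rewrite mulr_ge0.
have null : {ae tau, forall q, forall j, k j q = 0%R -> g j q = 0%R}.
  apply: filter_forall => j.
  (* Tested on the indicator of 0, [gk] says that [g] vanishes almost everywhere that [k] does, the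
     condition required by [gibbs_term]. *)
  pose h (x : R) : R := \1_[set 0%R] x.
  have mh : measurable_fun setT h by exact: measurable_indic.
  have h0 x : (0 <= h x)%R by rewrite /h indicE.
  have mhg : measurable_fun setT (fun q => (h (k j q) * g j q)%:E).
    apply/measurable_EFinP/measurable_funM => //.
    exact: measurableT_comp mh (mk j).
  have : \int[tau]_q `|(h (k j q) * g j q)%:E| = 0.
    under eq_integral do rewrite gee0_abs ?lee_fin ?mulr_ge0//.
    rewrite gk// integral0_eq// => q _; rewrite /h indicE.
    have [|/negP] := boolP (_ \in _); last by rewrite mul0r.
    by rewrite inE => ->; rewrite mulr0.
  move/(proj1 (ae_eq_integral_abs tau measurableT mhg)).
  apply: filterS => q /(_ Logic.I)[+ kq].
  by rewrite /h indicE mem_set// mul1r.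
have VW : \int[tau]_q (V q)%:E = \int[tau]_q (W q)%:E.
  rewrite /V /W; under eq_integral do rewrite -sumEFin.
  under [RHS]eq_integral do rewrite -sumEFin.
  have mln (f : J -> Q -> R) j : measurable_fun setT (f j) ->
      measurable_fun setT (fun q => (- ln (k j q) * f j q)%:E).
    by move=> mf; apply/measurable_EFinP/measurable_funM => //; exact: measurable_funN.
  rewrite ge0_integral_sum//; last 2 first.
  - by move=> j; exact: mln.
  - by move=> j q _; rewrite lee_fin mulr_ge0.
  rewrite [RHS]ge0_integral_sum//; last 2 first.
  - by move=> j; exact: mln.
  - by move=> j q _; rewrite lee_fin mulr_ge0.
  apply: eq_bigr => j _; rewrite (@gk j (fun x => - ln x)%R)//.
    exact: measurable_funN.
  by move=> x /andP[_ x1]; rewrite oppr_ge0 ln_le0.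
have VU : \int[tau]_q (V q)%:E <= \int[tau]_q (U q)%:E.
  rewrite VW; move: entropy_le; congr (_ <= _); apply: eq_integral => q _.
    by rewrite -sumrN; congr EFin; apply: eq_bigr => j _; rewrite mulNr mulrC.
  by rewrite -sumrN; congr EFin; apply: eq_bigr => j _; rewrite mulNr mulrC.
(* A finite integral is needed to cancel it below; [U] is bounded by the number of indices, whereas
   [V] has no pointwise bound. *)
have Ufin : \int[tau]_q (U q)%:E \is a fin_num.
  rewrite ge0_fin_numE; last by apply: integral_ge0 => q _; rewrite lee_fin.
  apply: (@le_lt_trans _ _ (\int[tau]_q (cst (#|J|%:R : R)%:E q))).
    apply: ge0_le_integral => //.
    - by move=> q _; rewrite lee_fin.
    - exact/measurable_EFinP.
    - move=> q _; rewrite lee_fin /U -sum1_card natr_sum; apply: ler_sum => j _.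
      rewrite mulNr mulrC (le_trans (oppr_mulr_ln_le1 _))//.
      by rewrite lerBlDr lerDl.
  by rewrite integral_cst// [X in _ * X](probability_setT tau) mule1 ltry.
(* [V - U] is nonnegative only off a null set; its positive part is so everywhere, and [V = U + D]
   then integrates without any subtraction. *)
pose D q := Num.max (V q - U q)%R 0%R.
have mD : measurable_fun setT D.
  by apply: measurable_maxr => //; exact: measurable_funB.
have D0 q : (0 <= D q)%R by rewrite /D le_max lexx orbT.
have UVterm q : (forall j, k j q = 0%R -> g j q = 0%R) ->
    (V q - U q = \sum_j (g j q * ln (g j q) - g j q * ln (k j q) - g j q + k j q))%R.
  move=> nq; rewrite big_split/= sumrB g1 k1 subrK /V /U -sumrB.
  by apply: eq_bigr => j _; ring.
have UD : \int[tau]_q (V q)%:E = \int[tau]_q (U q)%:E + \int[tau]_q (D q)%:E.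
  rewrite -ge0_integralD//; last 4 first.
  - by move=> q _; rewrite lee_fin.
  - exact/measurable_EFinP.
  - by move=> q _; rewrite lee_fin.
  - exact/measurable_EFinP.
  apply: ae_eq_integral => //.
  - exact/measurable_EFinP.
  - by apply: emeasurable_funD; exact/measurable_EFinP.
  move: null; apply: filterS => q nq _; rewrite -EFinD; congr EFin.
  rewrite /D max_l; first by rewrite addrC subrK.
  rewrite (UVterm q nq); apply: sumr_ge0 => j _.
  by have [] := gibbs_term (g00 j q) (k00 j q) (nq j).
have : \int[tau]_q `|(D q)%:E| = 0.
  under eq_integral do rewrite gee0_abs ?lee_fin//.
  apply/eqP; rewrite eq_le integral_ge0 ?andbT; last first.
    by move=> q _; rewrite lee_fin.
  by move: VU; rewrite UD -[leRHS]adde0 leeD2lE.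
have mDE : measurable_fun setT (EFin \o D) by exact/measurable_EFinP.
move/(proj1 (ae_eq_integral_abs tau measurableT mDE)).
move: null; apply: filterS2 => q nq /(_ Logic.I)[Dq0] j.
have : (V q - U q <= 0)%R by rewrite -Dq0 /D le_max lexx.
rewrite (UVterm q nq).
have t0 i := (gibbs_term (g00 i q) (k00 i q) (nq i)).
rewrite le_eqVlt ltNge sumr_ge0 ?orbF; last by move=> i _; have [] := t0 i.
rewrite psumr_eq0; last by move=> i _; have [] := t0 i.
move=> /allP /(_ j (mem_index_enum j)) /=; rewrite eq_sym.
by rewrite (t0 j) => /eqP.
Qed.

End gibbs.

(** * Topology of the shift and of the skew product *)

Lemma closed_borel_measurable (T : topologicalType) (o : T) (B : set T) :
  closed B -> measurable (B : set (borel o)).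
Proof.
move=> cB; rewrite -[B]setCK; apply: measurableC.
by apply: sub_sigma_algebra; exact: closed_openC.
Qed.

Lemma open_borel_measurable (T : topologicalType) (o : T) (B : set T) :
  open B -> measurable (B : set (borel o)).
Proof. exact: sub_sigma_algebra. Qed.

Lemma closed_image (T U : topologicalType) (f : T -> U) (B : set T) :
  compact [set: T] -> hausdorff_space U -> continuous f -> closed B ->
  closed (f @` B).
Proof.
move=> cT hU cf cB; apply: compact_closed => //; apply: continuous_compact.
  exact: continuous_subspaceT.
exact: subclosed_compact cB cT _.
Qed.

(* Measurability holds because the image of a closed subset of Y under f is
   compact. *)
Lemma measurable_factor (Y U V : topologicalType) (u : U) (v : V) (f : Y -> U)
    (g : Y -> V) (B : set Y) :
  compact [set: Y] -> hausdorff_space U -> continuous f -> continuous g ->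
  closed B -> (forall x y, B x -> B y -> f x = f y -> g x = g y) ->
  exists2 h : borel u -> borel v, measurable_fun setT h &
    forall x, B x -> h (f x) = g x.
Proof.
move=> cY hU cf cg cB fg.
pose h (z : borel u) : borel v :=
  if pselect (exists2 x, B x & f x = z) is left e then g (projT1 (cid2 e)) else v.
have hE x : B x -> h (f x) = g x.
  move=> Bx; rewrite /h; case: pselect => [e|[]]; last by exists x.
  by case: cid2 => /= y By /fg; exact.
exists h => //; apply: (@measurability _ _ (borel u) (borel v) _ _ (@open V)) => //.
move=> _ [G oG <-].
rewrite setTI -[_ @^-1` _]setCK; apply: measurableC; rewrite preimage_setC.
have cG : closed (~` G) by exact: open_closedC.
have mfB : measurable (f @` (B `&` g @^-1` (~` G)) : set (borel u)).
  apply: closed_borel_measurable; apply: closed_image => //.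
  apply: closedI => //.
  by apply: closed_comp => // x _; exact: cg.
have mf : measurable (f @` B : set (borel u)).
  by apply: closed_borel_measurable; exact: closed_image.
(* Off the image of [B] the function takes the default value [v], so the whole complement of the
   image is added exactly when [v] lies outside [G]. *)
have -> : h @^-1` (~` G) = f @` (B `&` g @^-1` (~` G)) `|`
    (~` (f @` B) `&` [set _ | ~ G v]).
  apply/seteqP; split => z.
    rewrite /preimage /= /h; case: pselect => [e|ne] Oz.
      left; move: Oz; case: cid2 => /= x Bx <- gx; exists x => //.
    by right; split => //; move=> [x Bx xz]; apply: ne; exists x.
  move=> [[x [Bx gx] <-]|[nz Ov]]; first by rewrite /preimage /= hE.
  rewrite /preimage /= /h; case: pselect => [[x Bx xz]|//].
  by exfalso; apply: nz; exists x.
apply: measurableU => //; apply: measurableI; first exact: measurableC.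
have [Ov|Ov] := pselect (G v).
  by rewrite (_ : [set _ | ~ G v] = set0)//; apply/seteqP; split.
by rewrite (_ : [set _ | ~ G v] = setT)//; apply/seteqP; split.
Qed.

Lemma hausdorff_separating (T : topologicalType) :
  (forall x y : T, x <> y -> exists (U : topologicalType) (f : T -> U),
    [/\ hausdorff_space U, continuous f & f x <> f y]) -> hausdorff_space T.
Proof.
move=> sep x y xy; apply: contrapT => /sep[U [f [hU cf]]]; apply.
apply: hU => P Q Px Qy.
have [z [Pz Qz]] := xy _ _ (cf x P Px) (cf y Q Qy).
by exists (f z).
Qed.

Lemma pair_hausdorff (T U : topologicalType) :
  hausdorff_space T -> hausdorff_space U -> hausdorff_space (T * U)%type.
Proof.
move=> hT hU; apply: hausdorff_separating => -[x1 x2] [y1 y2] xy.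
have [xy1|xy1] := pselect (x1 = y1); last first.
  by exists T, fst; split => // z; exact: cvg_fst.
exists U, snd; split => //; first by move=> z; exact: cvg_snd.
by move=> /= xy2; apply: xy; rewrite xy1 xy2.
Qed.

Lemma initial_cvg (T : choiceType) (U : topologicalType) (f : T -> U)
    (F : set_system (initial_topology f)) (x : initial_topology f) :
  Filter F -> f @ F --> f x -> F --> x.
Proof.
move=> FF fF P; rewrite nbhsE => -[_ [[G oG <-] Gx] GP].
by apply: filterS GP _; apply: fF; exact: open_nbhs_nbhs.
Qed.

(** The point [x] only serves to give [T] the pointed structure over which [compact_cover] is
    stated. *)
Lemma compact_cover_point (T : topologicalType) (x : T) (K : set T) :
  compact K -> cover_compact K.
Proof.
pose Tp : ptopologicalType := HB.pack T (isPointed.Build T x).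
by move=> cK; have : @compact Tp K by []; rewrite (@compact_cover Tp).
Qed.

Lemma fmap_ultra (T U : Type) (f : T -> U) (F : set_system T) :
  UltraFilter F -> UltraFilter (f @ F).
Proof.
move=> FU; split; first exact: fmap_proper_filter.
move=> G GP FG; apply/seteqP; split => // P GP'.
case: (in_ultra_setVsetC (f @^-1` P) FU) => // FP.
by have [x [Px nPx]] := filter_ex (filterI GP' (FG (~` P) FP)).
Qed.

Section tms_topology.
Context (A : finType) (M : rel A).
Local Notation Sigma := (tms M).

Lemma symb_inj (x y : Sigma) : (forall i, symb x i = symb y i) -> x = y.
Proof. by move=> xy; apply: val_inj; apply/funext. Qed.

Lemma symb_shift (x : Sigma) i : symb (tms_shift x) i = symb x (i + 1).
Proof. by []. Qed.

Lemma open_symb i a : open [set x : Sigma | symb x i = a].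
Proof.
have /continuousP := @symb_continuous A M i.
by move=> /(_ [set a]); apply; exact: discrete_open.
Qed.

Lemma closed_symb i a : closed [set x : Sigma | symb x i = a].
Proof.
have := @closed_comp Sigma (discrete_topology A) (fun x : Sigma => symb x i) [set a].
by apply; [move=> x _; exact: (@symb_continuous A M i x)|exact: discrete_closed].
Qed.

Lemma tms_hausdorff : hausdorff_space Sigma.
Proof.
apply: hausdorff_separating => x y xy.
have [i xyi] : exists i, symb x i <> symb y i.
  apply: contrapT => h; apply: xy; apply: symb_inj => i.
  by apply: contrapT => e; apply: h; exists i.
exists (discrete_topology A), (fun x : Sigma => symb x i); split => //.
  exact: discrete_hausdorff.
exact: (@symb_continuous A M i).
Qed.

Lemma tms_compact : compact [set: Sigma].
Proof.
rewrite compact_ultra => F FU _.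
pose W := prod_topology (fun _ : int => discrete_topology A).
have cW : compact [set f : W | forall i, [set: discrete_topology A] (f i)].
  apply: (@tychonoff int (fun=> discrete_topology A) (fun=> setT)) => i.
  by apply: finite_compact; exact: finite_finset.
have vU : UltraFilter ((set_val : Sigma -> W) @ F) by exact: fmap_ultra.
move: cW; rewrite compact_ultra => /(_ _ vU) [|y [_ Fy]].
  by apply: filterS filterT => x.
(* Along [F] each coordinate is eventually equal to its limit, and each constraint of [M] involves
   only two coordinates. *)
have My : tms_set M y.
  move=> i; have ci j : \forall x \near F, symb x j = y j.
    have := (cvg_comp _ _ Fy (@proj_continuous _ (fun _ : int => discrete_topology A) j y)).
    by move=> /(_ [set y j]); apply; exact: discrete_set1.
  have [x [<- <-]] := filter_ex (filterI (ci i) (ci (i + 1))).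
  by have /set_mem := valP x; exact.
exists (SigSub (mem_set My)); split => //=.
by apply: initial_cvg.
Qed.

Lemma past_hausdorff : hausdorff_space (past_space M).
Proof.
apply: hausdorff_separating => x y xy.
exists (prod_topology (fun _ : nat => discrete_topology A)), set_val; split.
- apply: hausdorff_product => i; exact: discrete_hausdorff.
- exact: initial_continuous.
- by move=> /val_inj.
Qed.

Lemma past_eq (x y : Sigma) :
  past x = past y <-> forall i : nat, symb x (Negz i) = symb y (Negz i).
Proof.
split=> [xy i|xy]; last by apply: val_inj; apply/funext => i; exact: xy.
by have := congr1 val xy => /(congr1 (@^~ i)).
Qed.

Lemma tms_shift_continuous : continuous (@tms_shift A M).
Proof.
apply: continuous_comp_initial => x.
have fx : Filter ((set_val \o @tms_shift A M) y @[y --> x]).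
  exact: (@fmap_filter _ _ (set_val \o @tms_shift A M) (nbhs x) (nbhs_filter x)).
apply/cvg_sup => i.
exact: (@continuous_comp_initial _ Sigma (discrete_topology A)
  (fun y : int -> A => y i) (fun x j => symb x (j + 1))
  (@symb_continuous A M (i + 1))).
Qed.

Lemma closed_cylinder n (w : n.-tuple A) : closed (@cylinder A M n w).
Proof.
rewrite (_ : cylinder w = \bigcap_(i in [set: 'I_n])
  [set x : Sigma | symb x (i : nat)%:Z = tnth w i]).
  by apply: closed_bigI => i _; exact: closed_symb.
by apply/seteqP; split => x h i; [move=> _; exact: h|exact: h].
Qed.

End tms_topology.

Lemma holder_modulus (R : realType) (T U : Type) (dT : T -> T -> R)
    (dU : U -> U -> R) (a e : R) (f : T -> U) : 0 < a -> holder dT dU a f ->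
  0 < e -> exists2 r : R, 0 < r &
    forall x y, 0 <= dT x y < r -> dU (f x) (f y) < e.
Proof.
(* [C] may be 0 or negative; [K] is positive and still dominates it. *)
move=> a0 [C fC] e0; pose K := `|C| + 1.
have K0 : 0 < K by rewrite ltr_wpDl.
exists ((e / K) `^ a^-1); first by rewrite powR_gt0// divr_gt0.
move=> x y /andP[d0 dr]; apply: le_lt_trans (fC x y) _.
have : dT x y `^ a < e / K.
  have := gt0_ltr_powR a0 d0 (powR_ge0 _ _) dr.
  by rewrite -powRrM mulVf ?gt_eqF// powRr1// divr_ge0// ltW.
rewrite ltr_pdivlMr// => h; apply: le_lt_trans h.
rewrite mulrC ler_wpM2l ?powR_ge0// (le_trans (ler_norm C))//.
by rewrite /K lerDl.
Qed.

Section shift_metric.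
Context (R : realType) (A : finType) (M : rel A).
Local Notation Sigma := (tms M).

Lemma shift_dist_ge0 (x y : Sigma) : 0 <= shift_dist R x y.
Proof.
apply: lb_le_inf; first by exists 1, 0%N; rewrite ?expr0 ?invr1.
by move=> _ [n _ <-]; rewrite invr_ge0 exprn_ge0.
Qed.

Lemma shift_dist_le (x y : Sigma) n :
  (forall i : int, (`|i| < n)%N -> symb x i = symb y i) ->
  shift_dist R x y <= 2 ^- n.
Proof.
move=> xy; apply: ge_inf; last by exists n.
by exists 0 => _ [m _ <-]; rewrite invr_ge0 exprn_ge0.
Qed.

Lemma near_symb (x : Sigma) n :
  \forall y \near x, forall i : int, (`|i| < n)%N -> symb x i = symb y i.
Proof.
have near1 (i : int) : \forall y \near x, symb x i = symb y i.
  have : nbhs x [set y : Sigma | symb y i = symb x i].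
    by apply: open_nbhs_nbhs; split => //; exact: open_symb.
  by apply: filterS => y ->.
have : \forall y \near x, forall j : 'I_n.+1,
    symb x j%:Z = symb y j%:Z /\ symb x (- j%:Z) = symb y (- j%:Z).
  apply: (@filter_forall Sigma 'I_n.+1 (fun j => [set y |
    symb x j%:Z = symb y j%:Z /\ symb x (- j%:Z) = symb y (- j%:Z)]) (nbhs x)).
  by move=> j; apply: filterI; exact: near1.
apply: filterS => y xy i ilt.
have [] := xy (Ordinal (ltnW ilt : (`|i| < n.+1)%N)); rewrite /= abszE.
by case: (lerP 0 i) => i0; [rewrite ger0_norm|rewrite ltr0_norm// opprK].
Qed.

Lemma near_shift_dist (x : Sigma) (r : R) : 0 < r ->
  \forall y \near x, shift_dist R x y < r.
Proof.
move=> r0; have [n nr] : exists n, 2 ^- n < r.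
  exists (Num.bound r^-1); rewrite -[ltRHS]invrK ltf_pV2 ?posrE ?invr_gt0//.
  apply: lt_trans (archi_boundP (ltW _)) _; first by rewrite invr_gt0.
  by rewrite -natrX ltr_nat ltn_expl.
apply: filterS (near_symb x n) => y xy.
exact: le_lt_trans (shift_dist_le xy) nr.
Qed.

End shift_metric.

Section skew_topology.
Context (R : realType) (A : finType) (M : rel A) (X : metricType R).
Local Notation Sigma := (tms M).
Variables (F : Sigma -> X -> X) (phi : Sigma -> R).

(** Compactness bounds the displacements, so the [sup] in [unif_dist] is a true supremum: every
    point is within the distance from [t] to a farthest point [m]. *)
Lemma mdist_le_unif_dist (f g : X -> X) t : compact [set: X] ->
  mdist (f t) (g t) <= unif_dist f g.
Proof.
move=> cX; apply: ub_le_sup; last by exists t.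
have cd : continuous (mdist t : X -> R).
  move=> s; apply/cvgrPdist_lt => e e0.
  have : \forall u \near s, mdist s u < e.
    exact: (@metricType_numDomainType.cvgr_dist_lt _ _ _ _ _ id s cvg_id e e0).
  apply: filterS => u /= su.
  have := metric_triangle t s u; have := metric_triangle t u s.
  by rewrite (metric_sym u s) ltr_norml => h1 h2; apply/andP; split; lra.
have [m _ mE] := @compact_EVT_max _ _ (mdist t : X -> R) setT
  (ex_intro _ t Logic.I) cX (continuous_subspaceT cd).
exists (mdist t m + mdist t m) => _ [s _ <-].
rewrite (le_trans (metric_triangle _ t _))// lerD//; last by apply: mE; rewrite inE.
by rewrite metric_sym; apply: mE; rewrite inE.
Qed.

(** Passing through [F x s], the uniform distance controls the change of base point and continuity
    of [F x] the change of fiber point. *)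
Lemma skew_continuous : compact [set: X] ->
  (forall w, continuous (F w)) ->
  holder_continuous (@shift_dist A M R) (@unif_dist R X) F ->
  continuous (fun z : Sigma * X => Defs.skew F z).
Proof.
move=> cX cF [a /andP[a0 _] hF] [x t].
apply: (@cvg_pair _ _ _ (nbhs (x, t)) (nbhs (tms_shift x)) (nbhs (F x t))
  (nbhs_filter _) (nbhs_filter _) (nbhs_filter _)
  (fun z : Sigma * X => tms_shift z.1) (fun z : Sigma * X => F z.1 z.2)).
  apply: (@continuous_comp (Sigma * X)%type Sigma Sigma fst tms_shift (x, t)); first exact: cvg_fst.
  exact: tms_shift_continuous.
apply/metricType_numDomainType.cvgrPdist_lt => e e0; have e20 : 0 < e / 2 by rewrite divr_gt0.
have [r r0 Fr] := holder_modulus a0 hF e20.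
exists ([set y | shift_dist R x y < r], [set s | mdist (F x t) (F x s) < e / 2]).
  split => /=; first exact: near_shift_dist.
  by apply: (metricType_numDomainType.cvgr_dist_lt (cF x t)).
move=> [y s] [/= yr sr]; apply: le_lt_trans (metric_triangle _ (F x s) _) _.
rewrite (splitr e) ltrD// (le_lt_trans (mdist_le_unif_dist _ _ _ cX))//.
by rewrite Fr// shift_dist_ge0.
Qed.

Lemma base_potential_continuous (phihat : Sigma * X -> R) (t : X) :
  holder_continuous (@skew_dist R A M X) (fun a b : R => `|a - b|) phihat ->
  (forall x s, phihat (x, s) = phi x) -> continuous phi.
Proof.
move=> [a /andP[a0 _] hp] pE x.
apply/(@cvgrPdist_lt _ _ _ (nbhs x) (nbhs_filter x)) => e e0.
have [r r0 pr] := holder_modulus a0 hp e0.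
apply: filterS (near_shift_dist x r0) => y xyr.
by rewrite -(pE x t) -(pE y t) pr// /skew_dist/= mdistxx max_l ?shift_dist_ge0.
Qed.

End skew_topology.

(** * Equality of the two pressures *)

Section birkhoff.
Context (R : realType) (A : finType) (M : rel A) (X : metricType R).
Local Notation Sigma := (tms M).
Variables (o : Sigma) (x0 : X) (F : Sigma -> X -> X).
Variables (phihat : Sigma * X -> R) (phi : Sigma -> R).
Hypothesis phihatE : forall x t, phihat (x, t) = phi x.

Lemma iter_skew1 n (z : Sigma * X) :
  (iter n (Defs.skew F) z).1 = iter n tms_shift z.1.
Proof. by elim: n => //= n ->. Qed.

Lemma birkhoff_skew n z :
  birkhoff (Defs.skew F) phihat n z = birkhoff tms_shift phi n z.1.
Proof.
apply: eq_bigr => k _; rewrite -iter_skew1.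
by case: (iter k _ z) => x t; rewrite phihatE.
Qed.

Lemma birkhoff_continuous n : continuous phi ->
  continuous (birkhoff tms_shift phi n : Sigma -> R).
Proof.
move=> cphi; rewrite /birkhoff.
apply: continuous_big => [|k _ x]; first exact: add_continuous.
apply: (@continuous_comp Sigma Sigma R (iter k tms_shift) phi x).
  elim: (nat_of_ord k) x => [|m IH] x; first exact: cvg_id.
  apply: (@continuous_comp Sigma Sigma Sigma (iter m tms_shift) tms_shift x).
    exact: IH.
  exact: tms_shift_continuous.
exact: cphi.
Qed.

Lemma poe_base : continuous phi -> poe o F phihat = pressure phi.
Proof.
move=> cphi; congr limn_esup; apply/funext => n.
rewrite (_ : [set _ | _ in _] = [set (n%:R^-1 * ln (\sum_(w : n.-tuple A | admissible M w)
       expR (sup [set birkhoff tms_shift phi n x | x in cylinder w])))%:E]).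
  by rewrite ereal_sup1.
suff E t : \sum_(w : n.-tuple A | admissible M w)
       expR (birkhoff (Defs.skew F) phihat n (theta o F phihat w t, t)) =
    \sum_(w : n.-tuple A | admissible M w)
       expR (sup [set birkhoff tms_shift phi n x | x in cylinder w]).
  apply/seteqP; split => [_ [t _ <-]|_ ->]; first by rewrite /= E.
  by exists x0 => //; rewrite E.
apply: eq_bigr => w /asboolP w0; congr expR; rewrite birkhoff_skew /=.
have cw : compact (@cylinder A M n w).
  apply: (@subclosed_compact _ _ setT) => //; first exact: closed_cylinder.
  exact: tms_compact.
(* A maximizer exists by compactness of the cylinder, so [theta] is not its default [o] on an
   admissible word. *)
have [z zw zmax] := compact_EVT_max w0 cw
  (continuous_subspaceT (birkhoff_continuous (n := n) cphi)).
rewrite inE in zw.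
have [thw thmax] : [set x | cylinder w x /\ forall y, cylinder w y ->
    birkhoff (Defs.skew F) phihat n (y, t) <= birkhoff (Defs.skew F) phihat n (x, t)]
    (theta o F phihat w t).
  apply: xgetPex; exists z; split => // y yw; rewrite !birkhoff_skew /=.
  by apply: zmax; rewrite inE.
apply/esym/eqP; rewrite eq_le; apply/andP; split.
  apply: ge_sup; first by case: w0 => v vw; exists (birkhoff tms_shift phi n v), v.
  by move=> _ [y yw <-]; have := thmax y yw; rewrite !birkhoff_skew.
apply: ub_le_sup; last by exists (theta o F phihat w t).
exists (birkhoff tms_shift phi n z) => _ [y yw <-].
by apply: zmax; rewrite inE.
Qed.

End birkhoff.

(** * Regularization of contents *)

(** Normality provides a neighborhood of [K \ V] with closure inside [U]. The two pieces may
    overlap, which is harmless for the subadditivity they serve. *)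
Lemma closed_split (Y : topologicalType) (K U V : set Y) :
  compact [set: Y] -> hausdorff_space Y -> closed K -> open U -> open V ->
  K `<=` U `|` V -> exists K1 K2, [/\ closed K1, closed K2, K1 `<=` U,
    K2 `<=` V & K = K1 `|` K2].
Proof.
move=> cY hY cK oU oV KUV.
have cKV : closed (K `\` V) by rewrite setDE; apply: closedI => //; exact: open_closedC.
have : set_nbhs (K `\` V) U.
  apply/set_nbhsP; exists U; split => // x [Kx nVx].
  by have [] := KUV x Kx.
move=> /(compact_normal hY cY cKV)[B /set_nbhsP[C [oC KVC CB]] clBU].
exists (K `&` closure B), (K `\` C); split.
- by apply: closedI => //; exact: closed_closure.
- by rewrite setDE; apply: closedI => //; exact: open_closedC.
- by move=> x [_ /clBU].
- move=> x [Kx nCx]; apply: contrapT => nVx; apply: nCx; exact: KVC.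
- apply/seteqP; split => [x Kx|x [[]|[]]//].
  have [Cx|nCx] := pselect (C x); last by right.
  by left; split => //; apply: subset_closure; exact: CB.
Qed.

Section regularization.
Local Open Scope ereal_scope.
Context (R : realType) (Y : topologicalType) (y0 : Y).
Local Notation T := (borel y0).
Variable m : set T -> R.
Hypothesis cY : compact [set: Y].
Hypothesis hY : hausdorff_space Y.
Hypothesis m_ge0 : forall B, measurable B -> (0 <= m B)%R.
Hypothesis m_add : forall B C, measurable B -> measurable C ->
  B `&` C = set0 -> (m (B `|` C) = m B + m C)%R.

Let mC (K : set Y) : closed K -> measurable (K : set T).
Proof. exact: closed_borel_measurable. Qed.

Let m_le (K L : set T) : measurable K -> measurable L -> K `<=` L ->
  (m K <= m L)%R.
Proof.
move=> mK mL KL; rewrite -(setDUK KL) m_add//; last 2 first.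
- exact: measurableD.
- by rewrite setDE setICA setICr setI0.
by rewrite lerDl m_ge0//; exact: measurableD.
Qed.

Let m0 : m set0 = 0%R.
Proof.
have := @m_add set0 set0 measurable0 measurable0 (setI0 _).
by rewrite setU0 => /eqP; rewrite -subr_eq0 opprD addrA subrr sub0r oppr_eq0 => /eqP.
Qed.

Let m_leU (K L : set T) : measurable K -> measurable L ->
  (m (K `|` L) <= m K + m L)%R.
Proof.
move=> mK mL; rewrite (_ : K `|` L = K `|` (L `\` K)); last first.
  apply/seteqP; split => [x [Kx|Lx]|x [Kx|[Lx _]]]; [by left| |by left|by right].
  by have [Kx|nKx] := pselect (K x); [left|right].
rewrite m_add//; last 2 first.
- exact: measurableD.
- by rewrite setDE setICA setICr setI0.
by rewrite lerD2l m_le//; exact: measurableD.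
Qed.

(* Topological regularization: [inner_content] restricted to open sets is
   countably subadditive by compactness, so closed sets are Caratheodory
   measurable for [outer_content], and the restriction of the latter to Borel
   sets is a measure although [m] is only finitely additive. *)
Definition inner_content (G : set Y) : \bar R :=
  ereal_sup [set (m K)%:E | K in [set K : set Y | closed K /\ K `<=` G]].

Lemma inner_content_ub (G K : set Y) : closed K -> K `<=` G ->
  (m K)%:E <= inner_content G.
Proof. by move=> cK KG; apply: ereal_sup_ubound; exists K. Qed.

Lemma inner_content_leP (G : set Y) (x : \bar R) :
  (forall K, closed K -> K `<=` G -> (m K)%:E <= x) -> inner_content G <= x.
Proof. by move=> h; apply: ge_ereal_sup => _ [K [cK KG] <-]; exact: h. Qed.

Lemma inner_content_ge0 G : 0 <= inner_content G.
Proof.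
have : (m set0)%:E <= inner_content G.
  by apply: inner_content_ub; [exact: closed0|].
by rewrite m0.
Qed.

Lemma inner_content_mono G H : G `<=` H -> inner_content G <= inner_content H.
Proof.
move=> GH; apply: inner_content_leP => K cK KG; apply: inner_content_ub => //.
exact: subset_trans GH.
Qed.

Lemma inner_content_fin G : inner_content G \is a fin_num.
Proof.
rewrite ge0_fin_numE ?inner_content_ge0//.
apply: (@le_lt_trans _ _ (m setT)%:E); last by rewrite ltry.
apply: inner_content_leP => K cK _; rewrite lee_fin; apply: m_le => //.
exact: mC.
Qed.

Lemma inner_content0 : inner_content set0 = 0.
Proof.
apply/eqP; rewrite eq_le inner_content_ge0 andbT; apply: inner_content_leP.
by move=> K _; rewrite subset0 => ->; rewrite m0.
Qed.

Lemma inner_contentU G H : open G -> open H ->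
  inner_content (G `|` H) <= inner_content G + inner_content H.
Proof.
move=> oG oH; apply: inner_content_leP => K cK KGH.
have [K1 [K2 [cK1 cK2 K1G K2H ->]]] := closed_split cY hY cK oG oH KGH.
apply: (@le_trans _ _ ((m K1)%:E + (m K2)%:E)).
  by rewrite -EFinD lee_fin; apply: m_leU; exact: mC.
by apply: leeD; exact: inner_content_ub.
Qed.

Lemma inner_content_bigcup (G : (set Y)^nat) : (forall n, open (G n)) ->
  inner_content (\bigcup_n G n) <= \sum_(n <oo) inner_content (G n).
Proof.
move=> oG; apply: inner_content_leP => K cK KG.
have cptK : compact K by exact: subclosed_compact cK cY _.
have [D _ KD] : finite_subset_cover [set: nat] G K.
  have cov := compact_cover_point y0 cptK.
  by apply: (cov nat setT G) => // i _; exact: oG.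
have [N KN] : exists N, K `<=` \big[setU/set0]_(i < N) G i.
  exists (\max_(i <- finmap.enum_fset D) i.+1)%N => x /KD[i /= Di Gix].
  rewrite -bigcup_mkord; exists i => //=.
  by rewrite (big_rem i)//= leq_max ltnSn.
apply: (@le_trans _ _ (inner_content (\big[setU/set0]_(i < N) G i))).
  exact: inner_content_ub.
apply: (@le_trans _ _ (\sum_(0 <= i < N) inner_content (G i))); last first.
  by apply: nneseries_lim_ge => n _ _; exact: inner_content_ge0.
rewrite big_mkord; elim: {KN} N => [|N IH].
  by rewrite !big_ord0 inner_content0.
rewrite !big_ord_recr/=; apply: le_trans (leeD2r _ IH).
apply: inner_contentU => //; rewrite -bigcup_mkord.
by apply: bigcup_open.
Qed.

Definition outer_content (E : set T) : \bar R :=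
  ereal_inf [set inner_content G | G in [set G : set Y | open G /\ E `<=` G]].

Lemma outer_content_lb (E G : set Y) : open G -> E `<=` G ->
  outer_content E <= inner_content G.
Proof. by move=> oG EG; apply: ereal_inf_lbound; exists G. Qed.

Lemma outer_content_geP (E : set Y) (x : \bar R) :
  (forall G, open G -> E `<=` G -> x <= inner_content G) -> x <= outer_content E.
Proof. by move=> h; apply: le_ereal_inf_tmp => _ [G [oG EG] <-]; exact: h. Qed.

Lemma outer_content_open (G : set Y) : open G -> outer_content G = inner_content G.
Proof.
move=> oG; apply/eqP; rewrite eq_le outer_content_lb//=.
by apply: outer_content_geP => H oH; exact: inner_content_mono.
Qed.

Let outer_content0 : outer_content set0 = 0.
Proof. by rewrite outer_content_open ?inner_content0//; exact: open0. Qed.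

Let outer_content_ge0 E : 0 <= outer_content E.
Proof. by apply: outer_content_geP => G _ _; exact: inner_content_ge0. Qed.

Let le_outer_content : {homo outer_content : E F / E `<=` F >-> E <= F}.
Proof.
move=> E F EF; apply: outer_content_geP => G oG FG.
by apply: outer_content_lb => //; exact: subset_trans FG.
Qed.

Let outer_content_fin E : outer_content E \is a fin_num.
Proof.
rewrite ge0_fin_numE//; apply: (@le_lt_trans _ _ (inner_content setT)).
  by apply: outer_content_lb => //; exact: openT.
by rewrite -ge0_fin_numE ?inner_content_ge0// inner_content_fin.
Qed.

Let outer_content_sigma_subadditive : sigma_subadditive outer_content.
Proof.
move=> E; apply/lee_addgt0Pr => e e0.
apply: le_trans (epsilon_trick _ _ (ltW e0)) => //.
have [G PG] : {G : (set Y)^nat & forall n, [/\ open (G n), E n `<=` G n &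
    inner_content (G n) <= outer_content (E n) + (e / (2 ^ n.+1)%:R)%:E]}.
  apply: (@choice _ _ (fun n G => [/\ open G, E n `<=` G &
    inner_content G <= outer_content (E n) + (e / (2 ^ n.+1)%:R)%:E])) => n.
  have en : (0 < e / (2 ^ n.+1)%:R)%R by rewrite divr_gt0// ltr0n expn_gt0.
  have [_ [G [oG EG] <-] Gn] := lb_ereal_inf_adherent en (outer_content_fin (E n)).
  by exists G; split => //; exact: ltW.
apply: (@le_trans _ _ (inner_content (\bigcup_n G n))).
  apply: outer_content_lb; first by apply: bigcup_open => n _; have [] := PG n.
  by move=> x [n _ Ex]; exists n => //; have [_ EG _] := PG n; exact: EG.
apply: le_trans (inner_content_bigcup _) _; first by move=> n; have [] := PG n.
apply: lee_nneseries => n _; first by move=> _; exact: inner_content_ge0.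
by have [] := PG n.
Qed.

HB.instance Definition _ := isOuterMeasure.Build R T outer_content
  outer_content0 outer_content_ge0 le_outer_content
  outer_content_sigma_subadditive.

(** Two nested exhaustions: a closed [K] inside the intersection of [H] and [G], then a closed [L]
    inside the open set [H \ K], which contains [E \ G]. As [K] and [L] are disjoint subsets of [H],
    additivity of [m] bounds the sum by the content of [H]. *)
Lemma open_caratheodory (G : set Y) : open G ->
  caratheodory_measurable outer_content G.
Proof.
move=> oG; apply: le_caratheodory_measurable => E.
apply: outer_content_geP => H oH EH.
apply: (@le_trans _ _ (inner_content (H `&` G) + outer_content (E `&` ~` G))).
  apply: leeD2r; apply: outer_content_lb; first exact: openI.
  exact: setSI.
rewrite -leeBrDr//; apply: inner_content_leP => K cK KHG.
rewrite leeBrDr// addeC -leeBrDr//.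
apply: (@le_trans _ _ (inner_content (H `\` K))).
  apply: outer_content_lb.
    by rewrite setDE; apply: openI => //; exact: closed_openC.
  by move=> x [Ex nGx]; split; [exact: EH|move/KHG => -[]].
apply: inner_content_leP => L cL LHK; rewrite leeBrDr// -EFinD -m_add.
- apply: inner_content_ub; first exact: closedU.
  by move=> x [/LHK[]|/KHG[]].
- exact: mC.
- exact: mC.
- by apply/seteqP; split => // x [/LHK[_ nK] /nK].
Qed.

Let measurable_caratheodory : measurable `<=` caratheodory_measurable outer_content.
Proof.
apply: smallest_sub; last exact: open_caratheodory.
split.
- exact: caratheodory_measurable_set0.
- by move=> B mB; rewrite setTD; exact: caratheodory_measurable_setC.
- by move=> B mB; exact: caratheodory_measurable_bigcup.
Qed.

Definition regularization : set T -> \bar R := outer_content.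

Let regularization_sigma_additive : semi_sigma_additive regularization.
Proof.
move=> B mB tB mUB; apply: caratheodory_measure_sigma_additive => //.
- by move=> n; exact: measurable_caratheodory.
- exact: measurable_caratheodory.
Qed.

HB.instance Definition _ := isMeasure.Build _ T R regularization
  outer_content0 outer_content_ge0 regularization_sigma_additive.

Definition regularization_measure : {measure set T -> \bar R} := regularization.

Lemma regularization_open (G : set Y) : open G ->
  regularization G = inner_content G.
Proof. exact: outer_content_open. Qed.

Lemma regularization_setT : regularization setT = (m setT)%:E.
Proof.
rewrite /regularization outer_content_open; last exact: openT.
apply/eqP; rewrite eq_le; apply/andP; split.
  apply: inner_content_leP => K cK _; rewrite lee_fin; apply: m_le => //.
  exact: mC.
by apply: inner_content_ub => //; exact: closedT.
Qed.

(** A continuous bijection of a compact Hausdorff space is a homeomorphism. It therefore permutes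
    the closed and the open sets over which the inner and outer contents range. *)
Lemma regularization_invariant (f : Y -> Y) : bijective f -> continuous f ->
  (forall B : set T, measurable B -> m (f @^-1` B) = m B) ->
  forall B : set T, regularization (f @^-1` B) = regularization B.
Proof.
move=> [g fK gK] cf mf.
have imE (B : set Y) : f @` B = g @^-1` B.
  by apply/seteqP; split => [_ [x Bx <-]|y By] /=; [rewrite fK|exists (g y)].
have preK (B : set Y) : f @^-1` (g @^-1` B) = B.
  by apply/seteqP; split => x; rewrite /preimage/= fK.
have preK' (B : set Y) : g @^-1` (f @^-1` B) = B.
  by apply/seteqP; split => x; rewrite /preimage/= gK.
have cg (B : set Y) : closed B -> closed (g @^-1` B).
  by move=> cB; rewrite -imE; exact: closed_image.
have og (B : set Y) : open B -> open (g @^-1` B).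
  by move=> oB; rewrite -closedC preimage_setC; apply: cg; exact: open_closedC.
have cfp (B : set Y) : closed B -> closed (f @^-1` B).
  by move=> cB; apply: closed_comp => // x _; exact: cf.
have ofp (B : set Y) : open B -> open (f @^-1` B).
  by move/continuousP : cf; exact.
have icE (G : set Y) : inner_content (f @^-1` G) = inner_content G.
  apply/eqP; rewrite eq_le; apply/andP; split; apply: inner_content_leP => K cK KG.
    rewrite -(preK K) mf; last exact: mC (cg _ cK).
    apply: inner_content_ub; first exact: cg.
    by move=> x /KG; rewrite /preimage /= gK.
  rewrite -mf; last exact: mC.
  apply: inner_content_ub; first exact: cfp.
  by move=> x /KG.
move=> B; apply/eqP; rewrite eq_le; apply/andP; split.
  apply: outer_content_geP => G oG BG; rewrite -icE.
  apply: outer_content_lb; first exact: ofp.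
  by move=> x /BG.
apply: outer_content_geP => G oG BG; rewrite -(preK G) icE.
apply: outer_content_lb; first exact: og.
by move=> x; rewrite -{1}(gK x) => /BG.
Qed.

End regularization.

(** * Set functions dominated by a measure *)

Section dominated_additive.
Local Open Scope ereal_scope.
Context d (T : measurableType d) (R : realType).
Variables (eta : {finite_measure set T -> \bar R}) (rho : set T -> \bar R).
Hypothesis rho_ge0 : forall B, measurable B -> 0 <= rho B.
Hypothesis rho_add : forall B C, measurable B -> measurable C ->
  B `&` C = set0 -> rho (B `|` C) = rho B + rho C.
Hypothesis rho_le : forall B, measurable B -> rho B <= eta B.

Lemma dominated_set0 : rho set0 = 0.
Proof.
by apply/eqP; rewrite eq_le rho_ge0// andbT -(measure0 eta) rho_le.
Qed.

(** The tail [rho (U \ V n)] is at most [eta (U \ V n)], which tends to 0; finite additivity of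
    [rho] does the rest. *)
Lemma dominated_sigma_additive : semi_sigma_additive rho.
Proof.
move=> B mB tB mUB; set U := \bigcup_n B n.
pose V n := \big[setU/set0]_(i < n) B i.
have mV n : measurable (V n) by exact: bigsetU_measurable.
have VU n : V n `<=` U.
  by rewrite /V -bigcup_mkord => x [i _ Bx]; exists i.
have VS n : V n `&` B n = set0.
  rewrite /V -bigcup_mkord; apply/seteqP; split => // x [[i /= ilt Bi] Bn].
  have /trivIsetP /(_ i n Logic.I Logic.I) := tB.
  by rewrite ltn_eqF// => /(_ isT); apply/eqP/set0P; exists x.
have rhoV n : rho (V n) = \sum_(0 <= i < n) rho (B i).
  elim: n => [|n IH]; first by rewrite big_nil /V big_ord0 dominated_set0.
  have -> : V n.+1 = V n `|` B n by rewrite /V big_ord_recr.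
  by rewrite rho_add// IH big_nat_recr.
have fin (C : set T) : measurable C -> rho C \is a fin_num.
  move=> mC; rewrite ge0_fin_numE ?rho_ge0//.
  by rewrite (le_lt_trans (rho_le mC))// ltey_eq fin_num_measure.
have split_U n : rho U = rho (V n) + rho (U `\` V n).
  rewrite -rho_add//; last first.
  - by rewrite setDE setICA setICr setI0.
  - exact: measurableD.
  by rewrite setDUK.
have etaV : (eta (V n)) @[n --> \oo] --> eta U.
  have := @measure_semi_sigma_additive _ _ _ eta B mB tB mUB.
  rewrite [X in X @ _ --> _ -> _](_ : _ = (fun n => eta (V n)))//.
  apply/funext => n; rewrite /V big_mkord -measure_bigsetU_ord//.
  by apply/trivIsetP => i j _ _ ij; have /trivIsetP := tB; exact.
have lo : (rho U - eta U + eta (V n)) @[n --> \oo] --> rho U.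
  rewrite -[X in _ --> X](@subeK _ _ (eta U)) ?fin_num_measure//.
  apply: cvgeD => //; last exact: cvg_cst.
  by rewrite fin_num_adde_defl// fin_num_measure.
apply: (squeeze_cvge _ lo (cvg_cst (rho U))).
near=> n; rewrite -rhoV; apply/andP; split.
  have mUV : measurable (U `\` V n) by exact: measurableD.
  have etaU : eta U = eta (V n) + eta (U `\` V n).
    rewrite -measureU//; last by rewrite setDE setICA setICr setI0.
    by rewrite setDUK.
  move: (rho_le mUV) (split_U n) etaU.
  rewrite -(fineK (fin _ mUB)) -(fineK (fin _ (mV n))) -(fineK (fin _ mUV)).
  rewrite -(fineK (fin_num_measure eta _ mUB)).
  rewrite -(fineK (fin_num_measure eta _ mUV)).
  rewrite -(fineK (fin_num_measure eta _ (mV n))) -!EFinD.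
  by rewrite lee_fin => h1 [h2] [h3]; rewrite lee_fin; lra.
rewrite (split_U n) leeDl// rho_ge0//; exact: measurableD.
Unshelve. all: by end_near. Qed.

End dominated_additive.

Section image_measure.
Context d d' (T : measurableType d) (Q : measurableType d') (R : realType).
Variables (m : {measure set T -> \bar R}) (p : {mfun T >-> Q}).

Definition image_measure : set Q -> \bar R := pushforward m p.

Let image_measure0 : image_measure set0 = 0%E.
Proof. by rewrite /image_measure /pushforward preimage_set0 measure0. Qed.

Let image_measure_ge0 B : (0 <= image_measure B)%E.
Proof. exact: measure_ge0. Qed.

Let image_measure_sigma_additive : semi_sigma_additive image_measure.
Proof. exact: measure_semi_sigma_additive. Qed.

HB.instance Definition _ := isMeasure.Build _ _ _ image_measure
  image_measure0 image_measure_ge0 image_measure_sigma_additive.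

End image_measure.

Section integral_le_slices.
Local Open Scope ereal_scope.
Context d d' (T : measurableType d) (Q : measurableType d') (R : realType).
Variables (a b : {measure set T -> \bar R}) (p : {mfun T >-> Q}) (D D' : set T).
Hypotheses (mD : measurable D) (mD' : measurable D').
Variable h : Q -> \bar R.
Hypothesis h0 : forall q, 0 <= h q.
Hypothesis mh : measurable_fun setT h.
Hypothesis slice : forall (r : R) P, (0 <= r)%R -> measurable P ->
  (forall q, P q -> r%:E <= h q) ->
  r%:E * a (D `&` p @^-1` P) <= b (D' `&` p @^-1` P).

Import HBNNSimple.

Let mp P : measurable P -> measurable (p @^-1` P).
Proof. by move=> mP; rewrite -[_ @^-1` _]setTI; exact: measurable_funP. Qed.

Let integral_nnsfun_le (f : {nnsfun Q >-> R}) :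
  (forall q, (f q)%:E <= h q) -> \int[a]_(x in D) (f (p x))%:E <= b D'.
Proof.
move=> fh; have mf r : measurable (f @^-1` [set r]) by [].
have -> : b D' = \sum_(r \in range f) b (D' `&` p @^-1` (f @^-1` [set r])).
  rewrite -measure_fin_bigcup//.
  - congr (b _); apply/seteqP; split => [x D'x|x [_ _ []]//].
    by exists (f (p x)) => //; exists (p x).
  - apply/trivIsetP => i j _ _ /eqP ij; apply/seteqP; split => // x.
    by move=> [[_ /= ->] [_ /ij]].
  - by move=> r _; apply: measurableI => //; exact: mp.
under eq_integral do rewrite fimfunE -fsumEFin//.
rewrite ge0_integral_fsum//; last 2 first.
- move=> r; apply/measurable_EFinP/measurable_funTS.
  apply: measurable_funM => //.
  exact: (measurableT_comp (measurable_indic (mf r)) (measurable_funPT p)).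
- by move=> r x _; rewrite EFinM nnfun_muleindic_ge0.
apply: lee_fsum => // r [q _ qr]; have r0 : (0 <= r)%R by rewrite -qr.
under eq_integral do rewrite EFinM.
have mI : measurable_fun D (fun x => (\1_(f @^-1` [set r]) (p x))%:E : \bar R).
  apply/measurable_EFinP/measurable_funTS.
  exact: (measurableT_comp (measurable_indic (mf r)) (measurable_funPT p)).
rewrite ge0_integralZl//.
rewrite (_ : (fun x => (\1_(f @^-1` [set r]) (p x))%:E) =
  (fun x => (\1_(p @^-1` (f @^-1` [set r])) x)%:E))//.
rewrite integral_indic//; last exact: mp.
by rewrite setIC; apply: slice => // y /= <-.
Qed.

(** A simple function below [h] is constant on its level sets, where [slice] applies; monotone
    convergence concludes. The hypothesis involves constants only, so it can be established where no
    integral is available yet. *)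
Lemma integral_le_slices : \int[a]_(x in D) h (p x) <= b D'.
Proof.
pose f := nnsfun_approx measurableT mh.
have fh q : (f n q)%:E @[n --> \oo] --> h q by exact: cvg_nnsfun_approx.
have ndf q : {homo (fun n => (f n q)%:E) : m n / (m <= n)%N >-> m <= n}.
  by move=> m n mn; rewrite lee_fin; exact/lefP/nd_nnsfun_approx.
have fle n q : (f n q)%:E <= h q.
  by rewrite /f nnsfun_approxE; exact: le_approx.
have mfp n : measurable_fun D (fun x => (f n (p x))%:E).
  apply: measurable_funTS; apply/measurable_EFinP.
  exact: (measurableT_comp _ (measurable_funPT p)).
have -> : \int[a]_(x in D) h (p x) =
    limn (fun n => \int[a]_(x in D) (f n (p x))%:E).
  rewrite -monotone_convergence//.
  - by apply: eq_integral => x _; apply/esym/cvg_lim => //; exact: fh.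
  - by move=> n x _; rewrite lee_fin.
apply: (@lime_le nat \oo eventually_filter R (b D')
  (fun n => \int[a]_(x in D) (f n (p x))%:E)); last first.
  by apply: nearW => n; apply: integral_nnsfun_le => q.
apply: ereal_nondecreasing_is_cvgn => m n mn; apply: ge0_le_integral => //.
- by move=> x _; rewrite lee_fin.
- by move=> x _; exact: ndf.
Qed.

End integral_le_slices.

(** * Cylinders and generators of the Borel sets *)

Lemma open_forall (T : topologicalType) (I : finType) (f : I -> set T) :
  (forall i, open (f i)) -> open [set x | forall i, f i x].
Proof.
move=> of_; rewrite openE => x fx.
apply: (@filter_forall T I f (nbhs x)) => i.
by apply: open_nbhs_nbhs; split.
Qed.

Section cylinders.
Context (A : finType) (M : rel A).
Local Notation Sigma := (tms M).

Definition past_symb (q : past_space M) : nat -> A := set_val q.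

Definition past_cylinder n (u : n.-tuple A) : set (past_space M) :=
  [set q | forall i : 'I_n, past_symb q i = tnth u i].

(** The window from [-n] to [n - 1] is cut at 0, so that its past half is a preimage under [past]
    and comes out of conditional measures given the past. *)
Definition two_sided_cylinder n (u w : n.-tuple A) : set Sigma :=
  cylinder w `&` past @^-1` past_cylinder u.

Lemma open_past_cylinder n (u : n.-tuple A) : open (past_cylinder u).
Proof.
apply: open_forall => i.
have ci : continuous (fun q : past_space M =>
    past_symb q i : discrete_topology A).
  move=> q; apply: (@continuous_comp (past_space M)
    (prod_topology (fun _ : nat => discrete_topology A)) _ past_symb
    (fun y => y (i : nat))).
    exact: initial_continuous.
  exact: (@proj_continuous _ (fun _ : nat => discrete_topology A) (i : nat)).
by move/continuousP : ci => /(_ [set tnth u i]); apply; exact: discrete_open.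
Qed.

(** Every point of the compact complement of [V] differs from [x] at some coordinate, and finitely
    many coordinates suffice for all of them. *)
Lemma cylinder_base (x : Sigma) (V : set Sigma) : open V -> V x ->
  exists n, forall y : Sigma,
    (forall i : int, (`|i| < n)%N -> symb y i = symb x i) -> V y.
Proof.
move=> oV Vx; have cV : compact (~` V).
  apply: (@subclosed_compact Sigma _ setT) => //; first exact: open_closedC.
  exact: tms_compact.
pose f (i : int) : set Sigma := [set y : Sigma | symb y i <> symb x i].
have of_ i : open (f i).
  rewrite (_ : f i = ~` [set y : Sigma | symb y i = symb x i])//.
  by apply: closed_openC; exact: closed_symb.
case: (compact_cover_point x cV (D := [set: int]) (f := f)) => [i _|y nVy|D _ DV].
- exact: of_.
- have [i yi] : exists i, symb y i <> symb x i.
    apply: contrapT => h; apply: nVy; suff -> : y = x by [].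
    by apply: symb_inj => i; apply: contrapT => e; apply: h; exists i.
  by exists i.
exists (\max_(i <- finmap.enum_fset D) `|i|.+1)%N => y yx.
apply: contrapT => /DV[i /= Di]; apply; apply: yx.
by rewrite (big_rem i)//= leq_max ltnSn.
Qed.

Lemma two_sided_cylinder_base (x : Sigma) (V : set Sigma) : open V -> V x ->
  exists n (u w : n.-tuple A), two_sided_cylinder u w x /\
    two_sided_cylinder u w `<=` V.
Proof.
move=> oV Vx; have [n nV] := cylinder_base oV Vx.
exists n, [tuple symb x (Negz i) | i < n], [tuple symb x (i : nat)%:Z | i < n].
split; first by split => i /=; rewrite tnth_mktuple.
move=> y [yw yu]; apply: nV => -[] i ilt.
  by have := yw (Ordinal ilt); rewrite tnth_mktuple.
(* [Negz i] has absolute value [i + 1], so the bound on it is one stronger than the bound on [i]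
   needed here. *)
by have := yu (Ordinal (ltnW ilt)); rewrite tnth_mktuple.
Qed.

Lemma open_two_sided_cylinder n (u w : n.-tuple A) :
  open (two_sided_cylinder u w).
Proof.
apply: openI.
  by apply: open_forall => i; exact: open_symb.
have /continuousP := @past_continuous A M.
by apply; exact: open_past_cylinder.
Qed.

Lemma clopen_two_sided_cylinder n (u w : n.-tuple A) :
  clopen (two_sided_cylinder u w).
Proof.
split; first exact: open_two_sided_cylinder.
apply: closedI; first exact: closed_cylinder.
rewrite (_ : past @^-1` past_cylinder u = \bigcap_(i in [set: 'I_n])
   [set x : Sigma | symb x (Negz i) = tnth u i]).
  by apply: closed_bigI => i _; exact: closed_symb.
by apply/seteqP; split => x h i; [move=> _; exact: h|exact: h].
Qed.

(** Words are countable in number, so [V] is a countable union of cylinders. Clopen sets are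
    preferred as generators because for clopen [C] the product with a closed set is closed and with
    an open set is open. *)
Lemma open_clopen_generated (V : set Sigma) : open V -> <<s @clopen Sigma >> V.
Proof.
move=> oV; have [->|/set0P[v _]] := eqVneq V set0; first exact: sigma_algebra0.

pose I := {n : nat & (n.-tuple A * n.-tuple A)%type}.
pose Z (i : I) : set Sigma := two_sided_cylinder (tagged i).1 (tagged i).2.
have -> : V = \bigcup_(i in [set i | Z i `<=` V]) Z i.
  apply/seteqP; split => [x Vx|x [i ZV /ZV]//].
  have [n [u [w [Zx ZV]]]] := two_sided_cylinder_base oV Vx.
  by exists (Tagged (fun n => n.-tuple A * n.-tuple A)%type (u, w)).
rewrite bigcup_mkcond.
pose Sp : pointedType := HB.pack Sigma (isPointed.Build Sigma v).
apply: (@countable_bigcupT_measurable _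
  (@g_sigma_algebraType Sp (@clopen Sigma))); first exact: countableP.
move=> i; case: ifPn => _; last exact: (@sigma_algebra0 _ _ _).
by apply: sub_sigma_algebra; exact: clopen_two_sided_cylinder.
Qed.

End cylinders.

Section skew_borel.
Context (A : finType) (M : rel A) (X : topologicalType).
Context (o : tms M) (x0 : X).
Local Notation Sigma := (tms M).
Local Notation SX := (borel ((o, x0) : Sigma * X)).
Variable E : set (set X).
Hypothesis openE : forall U : set X, open U ->
  exists G : nat -> set X, (forall n, E (G n)) /\ U = \bigcup_n G n.

Definition boxes : set (set SX) := [set B | exists n (u w : n.-tuple A) G,
  E G /\ B = two_sided_cylinder u w `*` G].

(** For each of the countably many cylinders [Z i], [U i] is the largest open set whose product with
    [Z i] lies in [D]. Only these sets [U i] are decomposed over [E], so [E] may be all open sets or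
    a countable base. *)
Lemma open_boxes (D : set (Sigma * X)) : open D -> <<s boxes >> D.
Proof.
move=> oD; pose I := {n : nat & (n.-tuple A * n.-tuple A)%type}.
pose Z (i : I) : set Sigma := two_sided_cylinder (tagged i).1 (tagged i).2.
pose U (i : I) : set X :=
  \bigcup_(V in [set V : set X | open V /\ Z i `*` V `<=` D]) V.
have oU i : open (U i) by apply: bigcup_open => V [].
have -> : D = \bigcup_i (Z i `*` U i).
  apply/seteqP; split => [[x t] Dxt|[x t] [i _ [/= Zx [V [oV ZV] Vt]]]]; last first.
    by apply: ZV.
  have : nbhs (x, t) D by exact: open_nbhs_nbhs.
  move=> [[P Q] /= [Px Qt] PQ].
  move: Px; rewrite nbhsE => -[P' [oP' P'x] P'P].
  move: Qt; rewrite nbhsE => -[Q' [oQ' Q't] Q'Q].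
  have [n [u [w [Zx ZP]]]] := two_sided_cylinder_base oP' P'x.
  exists (Tagged (fun n => n.-tuple A * n.-tuple A)%type (u, w)) => //; split => //=.
  exists Q' => //; split => // -[y s] [/= Zy Qs]; apply: PQ; split => /=.
    exact/P'P/ZP.
  exact: Q'Q.
apply: (@countable_bigcupT_measurable _ (g_sigma_algebraType boxes)).
  exact: countableP.
move=> i; have [G [EG ->]] := openE (oU i).
rewrite setX_bigcupr; apply: (@bigcupT_measurable _ (g_sigma_algebraType boxes)).
move=> n; apply: sub_sigma_algebra.
by exists (tag i), (tagged i).1, (tagged i).2, (G n).
Qed.

End skew_borel.

(** * The comparison measure *)

Section unshift.
Context (A : finType) (M : rel A).

Lemma tms_unshift_subproof (x : tms M) :
  (fun i : int => symb x (i - 1)) \in tms_set M.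
Proof.
apply/mem_set => i /=; have /set_mem /(_ (i - 1)) := valP x.
by rewrite subrK addrK.
Qed.

Definition tms_unshift (x : tms M) : tms M := SigSub (tms_unshift_subproof x).

Lemma tms_shift_bij : bijective (@tms_shift A M).
Proof.
exists tms_unshift => x; apply: symb_inj => i.
  by rewrite [LHS](symb_shift x) subrK.
by rewrite symb_shift -[in RHS](addrK 1 i).
Qed.

End unshift.

Lemma skew_bij (R : realType) (A : finType) (M : rel A) (X : metricType R)
    (F : tms M -> X -> X) : (forall w, bijective (F w)) ->
  bijective (Defs.skew F).
Proof.
move=> Fb; have [S TS ST] := @tms_shift_bij A M.
have [G GF] : {G : tms M -> X -> X & forall w, cancel (F w) (G w) /\ cancel (G w) (F w)}.
  apply: (@choice _ _ (fun w g => cancel (F w) g /\ cancel g (F w))) => w.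
  by have [g] := Fb w; exists g.
exists (fun z => (S z.1, G (S z.1) z.2)) => -[w t]; rewrite /Defs.skew /=.
  by rewrite TS (GF w).1.
by rewrite ST (GF (S w)).2.
Qed.

Lemma NegzS_add1 i : Negz i.+1 + 1 = Negz i.
Proof. by rewrite !NegzE intS opprD addrAC addNr add0r. Qed.

Section empirical.
Context (R : realType) (A : finType) (M : rel A) (X : metricType R).
Local Notation Sigma := (tms M).
Context (o : Sigma) (x0 : X) (F : Sigma -> X -> X).
Local Notation SX := (borel ((o, x0) : Sigma * X)).
Hypothesis cF : continuous (fun z : Sigma * X => Defs.skew F z).
Hypothesis Fpast : depends_on_past F.
Variable eta : probability (borel o) R.
Hypothesis eta_shift : forall B : set (borel o), measurable B ->
  eta (tms_shift @^-1` B) = eta B.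

(** The [k]-th image of the horizontal section at height [x0], parametrized by the starting base
    point. *)
Definition graph k (w : Sigma) : Sigma * X := iter k (Defs.skew F) (w, x0).

Lemma graph1 k w : (graph k w).1 = iter k tms_shift w.
Proof. by rewrite /graph iter_skew1. Qed.

Lemma graph_continuous k : continuous (graph k).
Proof.
elim: k => [|k IH] w.
  apply: (@cvg_pair _ _ _ (nbhs w) (nbhs w) (nbhs x0) (nbhs_filter _)
    (nbhs_filter _) (nbhs_filter _) id (fun=> x0)); first exact: cvg_id.
  exact: cvg_cst.
apply: (@continuous_comp Sigma (Sigma * X)%type (Sigma * X)%type (graph k)
  (Defs.skew F) w); first exact: IH.
exact: cF.
Qed.

Lemma measurable_graph k (B : set SX) : measurable B ->
  measurable (graph k @^-1` B : set (borel o)).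
Proof.
move=> mB; rewrite -[_ @^-1` _]setTI.
exact: (@continuous_measurable_borel _ _ o (o, x0) _ (@graph_continuous k)).
Qed.

Lemma eta_iter_shift k (B : set (borel o)) : measurable B ->
  eta (iter k tms_shift @^-1` B) = eta B.
Proof.
move=> mB; elim: k => // k <-; rewrite -[RHS]eta_shift.
  by congr (eta _); apply/seteqP; split => x; rewrite /preimage/= -iterS iterSr.
elim: k => // k IH; rewrite (_ : iter k.+1 tms_shift @^-1` B =
    tms_shift @^-1` (iter k tms_shift @^-1` B)); last first.
  by apply/seteqP; split => x; rewrite /preimage/= -iterS iterSr.
rewrite -[_ @^-1` _]setTI.
exact: (@continuous_measurable_borel _ _ o o _ (@tms_shift_continuous A M)).
Qed.

(** The image of [eta] under [graph k], kept real valued so that averages and limits are taken in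
    [R]. *)
Definition occupation k (B : set SX) : R := fine (eta (graph k @^-1` B)).

Let eta_fin (B : set (borel o)) : measurable B -> (eta B \is a fin_num)%E.
Proof. exact: fin_num_measure. Qed.

Lemma occupation_bounds k B : measurable B -> 0 <= occupation k B <= 1.
Proof.
move=> mB; have mg := measurable_graph k mB.
by rewrite fine_ge0//= -lee_fin fineK ?eta_fin// probability_le1.
Qed.

Lemma occupation_setT k : occupation k setT = 1.
Proof. by rewrite /occupation preimage_setT probability_setT. Qed.

Lemma occupationU k B C : measurable B -> measurable C -> B `&` C = set0 ->
  occupation k (B `|` C) = occupation k B + occupation k C.
Proof.
move=> mB mC BC; rewrite /occupation preimage_setU measureU.
- by rewrite fineD// eta_fin//; exact: measurable_graph.
- exact: measurable_graph.
- exact: measurable_graph.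
- by rewrite -preimage_setI BC preimage_set0.
Qed.

Lemma occupation_skew k B : occupation k (Defs.skew F @^-1` B) = occupation k.+1 B.
Proof. by []. Qed.

Lemma occupation_base k (B : set (borel o)) : measurable B ->
  occupation k (fst @^-1` B) = fine (eta B).
Proof.
move=> mB; rewrite /occupation -(eta_iter_shift k mB).
by congr (fine (eta _)); apply/seteqP; split => w; rewrite /preimage/= graph1.
Qed.

(* The X-coordinate of the k-th iterate only depends on the past of its base
   point: this is where F_w = F_(w_i)_(i <= 0) enters. *)
Lemma graph_past k (v w : Sigma) :
  past (iter k tms_shift v) = past (iter k tms_shift w) ->
  (graph k v).2 = (graph k w).2.
Proof.
elim: k => // k IH /past_eq vw.
have vwS i : symb (iter k tms_shift v) (Negz i) = symb (iter k tms_shift w) (Negz i).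
  by have := vw i.+1; rewrite !iterS !symb_shift NegzS_add1.
have {}IH : (graph k v).2 = (graph k w).2.
  exact/IH/past_eq.
have E (z : Sigma) : (graph k.+1 z).2 = F (iter k tms_shift z) (graph k z).2.
  by rewrite /graph iterS /Defs.skew/= iter_skew1.
rewrite !E IH; have -> // : F (iter k tms_shift v) = F (iter k tms_shift w).
by apply: Fpast => -[[|//]|i] _; [exact: (vw 0%N)|exact: vwS].
Qed.

Lemma graph_factor k : exists2 z : borel (past o) -> borel x0,
  measurable_fun setT z &
  forall w, z (past (iter k tms_shift w)) = (graph k w).2.
Proof.
have cT : continuous (fun w : Sigma => past (iter k tms_shift w)).
  move=> w; apply: (@continuous_comp Sigma Sigma (past_space M)
    (iter k tms_shift) past w); last exact: (@past_continuous A M _).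
  elim: k w => [|k IH] w; first exact: cvg_id.
  apply: (@continuous_comp Sigma Sigma Sigma (iter k tms_shift) tms_shift w).
    exact: IH.
  exact: tms_shift_continuous.
have cg : continuous (fun w : Sigma => (graph k w).2).
  move=> w; apply: (@continuous_comp Sigma (Sigma * X)%type X (graph k) snd w).
    exact: graph_continuous.
  exact: cvg_snd.
have [z mz zE] := @measurable_factor _ _ _ (past o) x0 _ _ setT
  (@tms_compact A M) (@past_hausdorff A M) cT cg closedT
  (fun v w _ _ => @graph_past k v w).
by exists z => // w; exact: zE.
Qed.

Variable kappa : R.-pker (borel (past o)) ~> (borel o).
Hypothesis keta : is_disintegration eta (@base_past A M o) kappa.

Lemma measurable_past_set1 (q : borel (past o)) : measurable [set q].
Proof.
apply: closed_borel_measurable; apply: compact_closed; last exact: compact_set1.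
exact: past_hausdorff.
Qed.

(** By [graph_factor] the condition that the fiber coordinate lies in [E] is an event [P'] on the
    past of the [k]-th shift. Shift invariance of [eta] undoes this shift, and what remains is the
    disintegration of [eta] over its past. *)
Lemma occupation_slice k (C : set (borel o)) (P : set (borel (past o)))
    (E : set (borel x0)) (r : R) :
  measurable C -> measurable P -> measurable E -> 0 <= r ->
  (forall q, P q -> (r%:E <= kappa q C)%E) ->
  r * occupation k ((past @^-1` P) `*` E) <=
  occupation k ((C `&` past @^-1` P) `*` E).
Proof.
move=> mC mP mE r0 rP; have [z mz zE] := graph_factor k.
pose P' : set (borel (past o)) := P `&` z @^-1` E.
have mP' : measurable P'.
  by apply: measurableI => //; rewrite -[_ @^-1` _]setTI; exact: mz.
have occE (D : set (borel o)) : measurable D ->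
    occupation k ((D `&` past @^-1` P) `*` E) =
    fine (eta (D `&` (@base_past A M o) @^-1` P')).
  move=> mD; rewrite -(eta_iter_shift k (B := D `&` _)); last first.
    apply: measurableI => //; rewrite -[_ @^-1` _]setTI.
    exact: measurable_base_past.
  congr (fine (eta _)); apply/seteqP; split => w /=.
    move=> [[]]; rewrite graph1 => Dw Pw Ew; split => //; split => //.
    by rewrite /preimage/= /base_past zE.
  move=> [Dw [Pw]]; rewrite /preimage /= /base_past zE => Ew.
  by split => //; rewrite graph1.
have := occE setT measurableT; rewrite !setTI => ->.
rewrite occE// -lee_fin EFinM fineK; last first.
  apply: eta_fin; rewrite -[_ @^-1` _]setTI; exact: measurable_base_past.
rewrite fineK; last first.
  apply: eta_fin; apply: measurableI => //.
  by rewrite -[_ @^-1` _]setTI; exact: measurable_base_past.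
rewrite (disintegration_setI keta measurable_past_set1)//.
have -> : (r%:E * eta ((@base_past A M o) @^-1` P') =
   \int[distribution eta (@base_past A M o)]_(q in P') r%:E)%E.
  by rewrite integral_cst.
apply: ge0_le_integral => //.
- exact: measurable_funTS (measurable_kernel kappa C mC).
- by move=> q [Pq _]; exact: rP.
Qed.

End empirical.

Lemma cvg_ultra_bounded (R : realType) (u : nat -> R) (U : set_system nat) :
  UltraFilter U -> (forall n, 0 <= u n <= 1) -> cvg (u @ U).
Proof.
move=> UU u01; have FU := fmap_ultra u UU.
have := @segment_compact R 0 1; rewrite compact_ultra => /(_ _ FU)[|l [_ ul]].
  apply: (@filterS _ U _ setT) => [n _|]; last exact: filterT.
  by rewrite /preimage /= in_itv/=; exact: u01.
by apply/cvg_ex; exists l.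
Qed.

(** * Limits of averaged images *)

Section limit_occupation.
Context (R : realType) (A : finType) (M : rel A) (X : metricType R).
Local Notation Sigma := (tms M).
Context (o : Sigma) (x0 : X) (F : Sigma -> X -> X).
Local Notation SX := (borel ((o, x0) : Sigma * X)).
Hypothesis cF : continuous (fun z : Sigma * X => Defs.skew F z).
Hypothesis Fpast : depends_on_past F.
Variable eta : probability (borel o) R.
Hypothesis eta_shift : forall B : set (borel o), measurable B ->
  eta (tms_shift @^-1` B) = eta B.

(** One ultrafilter gives limits on all Borel sets at once; diagonal extraction of a subsequence
    would handle countably many. *)
Let U : set_system nat := projT1 (cid (ultraFilterLemma eventually_filter)).

#[local] Instance U_ultra : UltraFilter U.
Proof. by rewrite /U; case: cid => V []. Qed.

Let U_eventually : \oo `<=` U.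
Proof. by rewrite /U; case: cid => V []. Qed.

Local Notation occ := (@occupation R A M X o x0 F eta).

(** With [n.+1] terms the average is never empty, so its total mass is 1 for every [n]. *)
Definition average n (B : set SX) : R :=
  n.+1%:R^-1 * \sum_(k < n.+1) occ k B.

(* A finitely additive set function only; countable additivity is recovered by
   regularization. *)
Definition limit_occupation (B : set SX) : R := lim (average n B @[n --> U]).

Lemma average_bounds n B : measurable B -> 0 <= average n B <= 1.
Proof.
move=> mB; have b k := occupation_bounds cF eta k mB.
rewrite /average mulr_ge0 ?invr_ge0//=; last first.
  by apply: sumr_ge0 => k _; case/andP: (b k).
rewrite ler_pdivrMl// mulr1 -[X in _ <= X%:R](card_ord n.+1) -sum1_card natr_sum.
by apply: ler_sum => k _; case/andP: (b k).
Qed.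

Lemma cvg_average B : measurable B ->
  average n B @[n --> U] --> limit_occupation B.
Proof.
by move=> mB; apply: cvg_ultra_bounded => n; exact: average_bounds.
Qed.

Lemma limit_occupation_ge0 B : measurable B -> 0 <= limit_occupation B.
Proof.
move=> mB; apply: (ler_cvg_to (cvg_cst 0) (cvg_average mB)).
by apply: nearW => n; case/andP: (average_bounds n mB).
Qed.

Lemma limit_occupationU B C : measurable B -> measurable C ->
  B `&` C = set0 ->
  limit_occupation (B `|` C) = limit_occupation B + limit_occupation C.
Proof.
move=> mB mC BC.
apply: (cvg_unique _ (cvg_average (measurableU _ _ mB mC))) => //.
have -> : (fun n => average n (B `|` C)) = (fun n => average n B) \+ (fun n => average n C).
  apply/funext => n; rewrite /average/= -mulrDr -big_split/=.
  by congr (_ * _); apply: eq_bigr => k _; rewrite occupationU.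
by apply: cvgD; exact: cvg_average.
Qed.

Lemma limit_occupation_cst B r : measurable B -> (forall k, occ k B = r) ->
  limit_occupation B = r.
Proof.
move=> mB occr; apply: (cvg_unique _ (cvg_average mB)) => //.
rewrite [X in X @ _](_ : _ = cst r); first exact: cvg_cst.
apply/funext => n; rewrite /average/= (eq_bigr (fun=> r)) => [|k _]; last exact: occr.
by rewrite sumr_const card_ord -[r *+ _]mulr_natl mulKf ?pnatr_eq0.
Qed.

Lemma limit_occupation_setT : limit_occupation setT = 1.
Proof. by apply: limit_occupation_cst => // k; exact: occupation_setT. Qed.

Lemma limit_occupation_base (B : set (borel o)) : measurable B ->
  limit_occupation (fst @^-1` B) = fine (eta B).
Proof.
move=> mB; apply: limit_occupation_cst => [|k].
  rewrite -[_ @^-1` _]setTI.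
  by apply: (@measurable_base_proj R A M X o x0).
exact: occupation_base.
Qed.

Lemma limit_occupation_skew (B : set SX) : measurable B ->
  limit_occupation (Defs.skew F @^-1` B) = limit_occupation B.
Proof.
move=> mB; have mSB : measurable (Defs.skew F @^-1` B : set SX).
  rewrite -[_ @^-1` _]setTI.
  exact: (@continuous_measurable_borel _ _ (o, x0) (o, x0) _ cF).
have d0 : (fun n => average n (Defs.skew F @^-1` B) - average n B) @ U --> (0 : R).
  suff h : (fun n => average n (Defs.skew F @^-1` B) - average n B) @ \oo --> (0 : R).
    by move=> V /h; exact: U_eventually.
  (* The sums telescope: only the occupations at times 0 and [n + 1] remain, both between 0 and
     1. *)
  have bound n : `|average n (Defs.skew F @^-1` B) - average n B| <= n.+1%:R^-1.
    rewrite /average -mulrBr normrM ger0_norm ?invr_ge0// ler_piMr ?invr_ge0//.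
    rewrite [X in X - _]big_ord_recr/= [X in _ - X]big_ord_recl/=.
    have -> : \sum_(i < n) occ (bump 0 i) B =
        \sum_(i < n) occ i (Defs.skew F @^-1` B).
      by apply: eq_bigr => i _; rewrite occupation_skew /bump.
    rewrite occupation_skew.
    have := occupation_bounds cF eta n.+1 mB; have := occupation_bounds cF eta 0 mB.
    by move=> /andP[? ?] /andP[? ?]; rewrite ler_norml; apply/andP; split; lra.
  apply/cvgr0Pnorm_le => e e0; have := near_infty_natSinv_lt (PosNum e0).
  by apply: filterS => n /= ne; apply: le_trans (bound n) _; exact: ltW.
apply: (cvg_unique _ (cvg_average mSB)) => //.
rewrite -[limit_occupation B]add0r.
have -> : (fun n => average n (Defs.skew F @^-1` B)) =
    (fun n => (average n (Defs.skew F @^-1` B) - average n B) + average n B).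
  by apply/funext => n; rewrite subrK.
exact: cvgD d0 (cvg_average mB).
Qed.

Variable kappa : R.-pker (borel (past o)) ~> (borel o).
Hypothesis keta : is_disintegration eta (@base_past A M o) kappa.

Lemma measurable_base_pastI (P : set (borel (past o))) : measurable P ->
  measurable (past @^-1` P : set (borel o)).
Proof.
by move=> mP; rewrite -[_ @^-1` _]setTI; exact: measurable_base_past.
Qed.

Lemma measurable_box (B : set (borel o)) (E : set (borel x0)) :
  measurable B -> measurable E -> measurable (B `*` E : set SX).
Proof.
move=> mB mE; rewrite (_ : B `*` E = fst @^-1` B `&` snd @^-1` E); last first.
  by apply/seteqP; split.
apply: measurableI; rewrite -[_ @^-1` _]setTI.
  by apply: (@measurable_base_proj R A M X o x0).
apply: (@continuous_measurable_borel (Sigma * X)%type X (o, x0) x0 snd) => //.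
by move=> x; exact: cvg_snd.
Qed.

Lemma limit_occupation_slice (C : set (borel o)) (P : set (borel (past o)))
    (E : set (borel x0)) (r : R) :
  measurable C -> measurable P -> measurable E -> 0 <= r ->
  (forall q, P q -> (r%:E <= kappa q C)%E) ->
  r * limit_occupation ((past @^-1` P) `*` E) <=
  limit_occupation ((C `&` past @^-1` P) `*` E).
Proof.
move=> mC mP mE r0 rP; have mpP := measurable_base_pastI mP.
have mPE := measurable_box mpP mE.
have mCPE := measurable_box (measurableI _ _ mC mpP) mE.
have rc : r * average n ((past @^-1` P) `*` E : set SX) @[n --> U] -->
    r * limit_occupation ((past @^-1` P) `*` E).
  by apply: cvgM; [exact: cvg_cst|exact: cvg_average].
apply: (ler_cvg_to rc (cvg_average mCPE)); apply: nearW => n.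
rewrite /average mulrCA ler_wpM2l ?invr_ge0// mulr_sumr; apply: ler_sum => k _.
exact: (occupation_slice cF Fpast eta_shift keta).
Qed.

End limit_occupation.

(** * The regularized limit on boxes *)

Section comparison.
Context (R : realType) (A : finType) (M : rel A) (X : metricType R).
Local Notation Sigma := (tms M).
Context (o : Sigma) (x0 : X) (F : Sigma -> X -> X).
Local Notation SX := (borel ((o, x0) : Sigma * X)).
Hypothesis cX : compact [set: X].
Hypothesis cF : continuous (fun z : Sigma * X => Defs.skew F z).
Hypothesis Fbij : forall w, bijective (F w).
Hypothesis Fpast : depends_on_past F.
Variable eta : probability (borel o) R.
Hypothesis eta_shift : forall B : set (borel o), measurable B ->
  eta (tms_shift @^-1` B) = eta B.

Lemma skew_compact : compact [set: Sigma * X].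
Proof. by rewrite -setXTT; apply: compact_setX => //; exact: tms_compact. Qed.

Lemma skew_hausdorff : hausdorff_space (Sigma * X)%type.
Proof.
by apply: pair_hausdorff; [exact: tms_hausdorff|exact: metric_hausdorff].
Qed.

Local Notation lim_occ := (@limit_occupation R A M X o x0 F eta).

Definition comparison : set SX -> \bar R :=
  regularization_measure skew_compact skew_hausdorff
    (@limit_occupation_ge0 R A M X o x0 F cF eta) (@limit_occupationU R A M X o x0 F cF eta).

HB.instance Definition _ := Measure.on comparison.

Let comparison_setT : comparison setT = 1%E.
Proof.
rewrite [LHS](regularization_setT (@limit_occupation_ge0 R A M X o x0 F cF eta)
  (@limit_occupationU R A M X o x0 F cF eta)).
by rewrite limit_occupation_setT.
Qed.

HB.instance Definition _ :=
  Measure_isProbability.Build _ _ _ comparison comparison_setT.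

Lemma comparison_open (G : set (Sigma * X)) : open G ->
  comparison G = inner_content lim_occ G.
Proof. exact: regularization_open. Qed.

Lemma comparison_invariant : skew_invariant F comparison.
Proof.
move=> B mB; apply: (regularization_invariant skew_compact skew_hausdorff).
- exact: skew_bij.
- exact: cF.
- by move=> C mC; exact: limit_occupation_skew.
Qed.

Let closed_setX (B : set Sigma) (K : set X) : closed B -> closed K ->
  closed (B `*` K).
Proof.
move=> cB cK; rewrite (_ : B `*` K = fst @^-1` B `&` snd @^-1` K); last first.
  by apply/seteqP; split.
apply: closedI; apply: closed_comp => // x _; [exact: cvg_fst|exact: cvg_snd].
Qed.

Let open_setX (B : set Sigma) (K : set X) : open B -> open K ->
  open (B `*` K).
Proof.
move=> oB oK; rewrite (_ : B `*` K = fst @^-1` B `&` snd @^-1` K); last first.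
  by apply/seteqP; split.
by apply: openI; apply: open_comp => // x _; [exact: cvg_fst|exact: cvg_snd].
Qed.

Lemma limit_occupation_le (B C : set SX) : measurable B -> measurable C ->
  B `<=` C -> lim_occ B <= lim_occ C.
Proof.
move=> mB mC BC; have mCB : measurable (C `\` B) by exact: measurableD.
rewrite -(setDUK BC) (limit_occupationU cF)//.
- by rewrite lerDl (limit_occupation_ge0 cF).
- by rewrite setDE setICA setICr setI0.
Qed.

(* [lim_occ (B `*` K)] is countably additive in [B], being dominated by [eta]; the
   supremum over [K] makes [box_content] agree with [comparison] on boxes. *)
Definition box_content (E : set X) (B : set (borel o)) : \bar R :=
  ereal_sup [set (lim_occ (B `*` K))%:E | K in [set K | closed K /\ K `<=` E]].

Let box_content_ub E B K : closed K -> K `<=` E ->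
  ((lim_occ (B `*` K))%:E <= box_content E B)%E.
Proof. by move=> cK KE; apply: ereal_sup_ubound; exists K. Qed.

Let box_content_leP E B x :
  (forall K, closed K -> K `<=` E -> ((lim_occ (B `*` K))%:E <= x)%E) ->
  (box_content E B <= x)%E.
Proof. by move=> h; apply: ge_ereal_sup => _ [K [cK KE] <-]; exact: h. Qed.

Let mbox (B : set (borel o)) (K : set X) : measurable B -> closed K ->
  measurable (B `*` K : set SX).
Proof.
by move=> mB cK; apply: measurable_box => //; exact: closed_borel_measurable.
Qed.

Let box_content_ge0 E B : (0 <= box_content E B)%E.
Proof.
apply: le_trans (box_content_ub B (@closed0 X) (@sub0set _ E)).
by rewrite lee_fin setX0 (limit_occupation_ge0 cF).
Qed.

Let box_content_le E B : measurable B -> (box_content E B <= eta B)%E.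
Proof.
move=> mB; apply: box_content_leP => K cK KE.
rewrite -[leRHS]fineK ?fin_num_measure// lee_fin.
rewrite -(limit_occupation_base x0 cF eta_shift mB).
apply: limit_occupation_le; first exact: mbox.
  by rewrite -[_ @^-1` _]setTI; apply: (@measurable_base_proj R A M X o x0).
by move=> x [].
Qed.

Let box_content_fin E B : measurable B -> box_content E B \is a fin_num.
Proof.
move=> mB; rewrite ge0_fin_numE ?box_content_ge0//.
by rewrite (le_lt_trans (box_content_le E mB))// ltey_eq fin_num_measure.
Qed.

Let box_contentU E B C : measurable B -> measurable C -> B `&` C = set0 ->
  (box_content E (B `|` C) = box_content E B + box_content E C)%E.
Proof.
move=> mB mC BC; have mBC : measurable (B `|` C) by exact: measurableU.
have limU K : closed K ->
    lim_occ ((B `|` C) `*` K) = lim_occ (B `*` K) + lim_occ (C `*` K).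
  move=> cK; rewrite -(limit_occupationU cF)//.
  - by congr lim_occ; apply/seteqP; split => [[x t] [[]]|[x t] [] []]/=; tauto.
  - exact: mbox.
  - exact: mbox.
  - apply/seteqP; split => // -[x t] [[/= Bx _] [/= Cx _]].
    by have : (B `&` C) x by []; rewrite BC.
apply/eqP; rewrite eq_le; apply/andP; split.
  apply: box_content_leP => K cK KE; rewrite limU// EFinD.
  by apply: leeD; exact: box_content_ub.
rewrite -leeBrDr ?box_content_fin//; apply: box_content_leP => K cK KE.
rewrite leeBrDr ?box_content_fin// addeC -leeBrDr//.
apply: box_content_leP => L cL LE; rewrite leeBrDr// -EFinD.
apply: (@le_trans _ _ (lim_occ ((B `|` C) `*` (K `|` L)))%:E); last first.
  by apply: box_content_ub; [exact: closedU|move=> x [/KE|/LE]].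
have cKL : closed (K `|` L) by exact: closedU.
rewrite lee_fin limU// addrC lerD//; apply: limit_occupation_le.
- exact: mbox.
- exact: mbox.
- by move=> [x t] [/= Bx Kt]; split => //; left.
- exact: mbox.
- exact: mbox.
- by move=> [x t] [/= Bx Kt]; split => //; right.
Qed.

(** Both sides are measures in [B], so clopen [C] suffice. There, a closed subset of the open box
    over [C] and [E] enlarges to the product of [C] with its projection to [X], which is closed by
    compactness: products exhaust the box. *)
Lemma comparison_box (E : set X) (B : set (borel o)) : open E -> measurable B ->
  comparison (B `*` E) = box_content E B.
Proof.
move=> oE mB.
have box0 : box_content E set0 = 0%E.
  by apply/eqP; rewrite eq_le box_content_ge0 andbT -(measure0 eta) box_content_le.
have box_sigma : semi_sigma_additive (box_content E).
  apply: (dominated_sigma_additive (eta := eta)) => //.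
  - by move=> C D mC mD; exact: box_contentU.
  - by move=> C mC; exact: box_content_le.
pose rho : {measure set (borel o) -> \bar R} := HB.pack (box_content E)
  (isMeasure.Build _ _ _ (box_content E) box0 (box_content_ge0 E) box_sigma).
have mTE : measurable (setT `*` E : set SX).
  by apply: measurable_box => //; exact: open_borel_measurable.
pose nu : {measure set (borel o) -> \bar R} :=
  image_measure (mrestr comparison mTE) (@base_proj R A M X o x0).
have nuE (C : set (borel o)) : nu C = comparison (C `*` E).
  rewrite /nu /= /image_measure /pushforward /mrestr; congr comparison.
  by apply/seteqP; split => [[x t] [/= Cx [_ Et]]|[x t] [/= Cx Et]].
rewrite -nuE.
have cm : @clopen Sigma `<=` (measurable : set (set (borel o))).
  by move=> C [oC _]; exact: open_borel_measurable.
apply: (@g_sigma_algebra_measure_unique _ _ (borel o) (@clopen Sigma) cm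
  (fun=> setT) _ _ nu rho).
- by move=> i; split; [exact: openT|exact: closedT].
- by apply/seteqP; split => // x _; exists 0%N.
- by move=> C D [oC cC] [oD cD]; split; [exact: openI|exact: closedI].
- move=> C [oC cC]; rewrite nuE comparison_open; last exact: open_setX.
  apply/eqP; rewrite eq_le; apply/andP; split.
    apply: inner_content_leP => K cK KCE.
    have csK : closed (snd @` K).
      apply: closed_image => //; [exact: skew_compact|exact: metric_hausdorff|].
      by move=> z; exact: cvg_snd.
    apply: le_trans (box_content_ub C csK _); last first.
      by move=> _ [z Kz <-]; have [] := KCE z Kz.
    rewrite lee_fin; apply: limit_occupation_le.
    + exact: closed_borel_measurable.
    + by apply: mbox => //; exact: cm.
    + by move=> z Kz; split; [have [] := KCE z Kz|exists z].
  apply: box_content_leP => K cK KE; apply: inner_content_ub.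
    exact: closed_setX.
  by move=> [x t] [/= Cx Kt]; split => //; exact: KE.
- by move=> k; rewrite (@le_lt_trans _ _ 1%E) ?ltry// nuE; exact: probability_le1.
- have : measurable B := mB; apply: smallest_sub.
    exact: smallest_sigma_algebra.
  by move=> V oV; exact: open_clopen_generated.
Qed.

Lemma comparison_base (B : set (borel o)) : measurable B ->
  comparison (fst @^-1` B) = eta B.
Proof.
move=> mB; have -> : fst @^-1` B = B `*` [set: X] by apply/seteqP; split => // x [].
rewrite comparison_box//; last exact: openT.
apply/eqP; rewrite eq_le box_content_le//=.
apply: le_trans (box_content_ub B closedT (@subset_refl _ setT)).
have -> : B `*` [set: X] = fst @^-1` B by apply/seteqP; split => // x [].
by rewrite (limit_occupation_base x0 cF eta_shift mB) fineK ?fin_num_measure.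
Qed.

Variable kappa : R.-pker (borel (past o)) ~> (borel o).
Hypothesis keta : is_disintegration eta (@base_past A M o) kappa.

Lemma comparison_slice (C : set (borel o)) (P : set (borel (past o)))
    (E : set X) (r : R) :
  measurable C -> measurable P -> open E -> 0 <= r ->
  (forall q, P q -> (r%:E <= kappa q C)%E) ->
  (r%:E * comparison ((past @^-1` P) `*` E) <=
   comparison ((C `&` past @^-1` P) `*` E))%E.
Proof.
move=> mC mP oE r0 rP; have mpP := measurable_base_pastI mP.
have mCP := measurableI _ _ mC mpP.
rewrite comparison_box// comparison_box//.
(* The bound is proved inside the supremum after division by [r], which sets [r = 0] apart. *)
have [->|rN0] := eqVneq r 0; first by rewrite mul0e box_content_ge0.
have rp : 0 < r by rewrite lt_neqAle eq_sym rN0.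
rewrite muleC -lee_pdivlMr//; apply: box_content_leP => K cK KE.
rewrite lee_pdivlMr// muleC -EFinM; apply: le_trans (box_content_ub _ cK KE).
rewrite lee_fin.
apply: (limit_occupation_slice cF Fpast eta_shift keta) => //.
exact: closed_borel_measurable.
Qed.

Lemma comparison_integral_le (C : set (borel o)) (E : set X) :
  measurable C -> open E ->
  (\int[comparison]_(x in setT `*` E) kappa (past x.1) C <=
   comparison (C `*` E))%E.
Proof.
move=> mC oE; have mE : measurable (E : set (borel x0)).
  exact: open_borel_measurable.
apply: (@integral_le_slices _ _ _ _ R comparison comparison
  (@past_proj R A M X o x0) (setT `*` E) (C `*` E) _ _ (kappa ^~ C)) => //.
- exact: measurable_box.
- exact: measurable_box.
- exact: measurable_kernel.
move=> r P r0 mP rP.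
have -> : (setT `*` E) `&` (@past_proj R A M X o x0) @^-1` P = (past @^-1` P) `*` E.
  by apply/seteqP; split => [[x t] [[_ Et] Px]|[x t] [Px Et]].
have -> : (C `*` E) `&` (@past_proj R A M X o x0) @^-1` P =
    (C `&` past @^-1` P) `*` E.
  by apply/seteqP; split => [[x t] [[Cx Et] Px]|[x t] [[Cx Px] Et]].
exact: comparison_slice.
Qed.

(** The one-sided bounds for [C] and for its complement add up to an equality of finite masses,
    because the two values of [kappa] sum to 1; hence neither bound is strict. *)
Lemma comparison_integral (C : set (borel o)) (E : set X) :
  measurable C -> open E ->
  comparison (C `*` E) =
  (\int[comparison]_(x in setT `*` E) kappa (past x.1) C)%E.
Proof.
move=> mC oE; have mE : measurable (E : set (borel x0)).
  exact: open_borel_measurable.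
have mTE : measurable (setT `*` E : set SX) by exact: measurable_box.
have mk (D : set (borel o)) : measurable D ->
    measurable_fun (setT `*` E : set SX) (fun x => kappa (past x.1) D).
  move=> mD; apply: measurable_funTS.
  exact: measurableT_comp (measurable_kernel kappa D mD)
    (measurable_funPT (@past_proj R A M X o x0)).
have mCc : measurable (~` C) by exact: measurableC.
have h1 := comparison_integral_le mC oE.
have h2 := comparison_integral_le mCc oE.
have sum1 : (\int[comparison]_(x in setT `*` E) kappa (past x.1) C +
    \int[comparison]_(x in setT `*` E) kappa (past x.1) (~` C) =
    comparison (setT `*` E))%E.
  rewrite -ge0_integralD//; [|exact: mk|exact: mk].
  rewrite -[RHS]mul1e -integral_cst//; apply: eq_integral => x _.
  by rewrite -measureU ?setICr// setUCr; exact: prob_kernel.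
have sum2 : (comparison (C `*` E) + comparison (~` C `*` E) =
    comparison (setT `*` E))%E.
  rewrite -measureU; [|exact: measurable_box|exact: measurable_box|].
    congr comparison; apply/seteqP; split => [[x t] [[]|[]]//|[x t] [/= _ Et]].
    by have [Cx|Cx] := pselect (C x); [left|right].
  by apply/seteqP; split => // -[x t] [[/= Cx _] [/= nCx _]].
have fin (B : set SX) : measurable B -> comparison B \is a fin_num.
  exact: fin_num_measure.
have fin1 := fin _ (measurable_box mC mE).
have fin2 := fin _ (measurable_box mCc mE).
apply/eqP; rewrite eq_le h1 andbT.
rewrite -(leeD2rE _ _ fin2) sum2 -sum1; exact: leeD2l.
Qed.

End comparison.

(** * Conditional measures of the comparison measure *)

Lemma measurable_skew_boxes (A : finType) (M : rel A) (X : topologicalType)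
    (o : tms M) (x0 : X) d (T : measurableType d)
    (g : T -> borel ((o, x0) : tms M * X)) :
  (forall n (u w : n.-tuple A) (E : set X), open E ->
    measurable (g @^-1` (two_sided_cylinder u w `*` E))) ->
  measurable_fun setT g.
Proof.
move=> mg.
pose G := [set B : set (borel ((o, x0) : tms M * X)) | measurable (g @^-1` B)].
have sG : sigma_algebra setT G.
  split; rewrite /G /=.
  - by rewrite preimage_set0.
  - by move=> B mB; rewrite setTD -preimage_setC; exact: measurableC.
  - by move=> B mB; rewrite preimage_bigcup; exact: bigcupT_measurable.
move=> _ B mB; rewrite setTI; apply: (smallest_sub sG _ mB) => V oV.
apply: (smallest_sub sG) (open_boxes (o := o) (x0 := x0) (E := @open X) _ oV).
  by move=> _ [n [u [w [E [oE ->]]]]]; exact: mg.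
move=> U oU; exists (fun=> U); split => //.
by apply/seteqP; split => [x Ux|x [_ _]//]; exists 0%N.
Qed.

Section fiber_kernel.
Context (R : realType) (A : finType) (M : rel A) (X : metricType R).
Local Notation Sigma := (tms M).
Context (o : Sigma) (x0 : X).
Local Notation SX := (borel ((o, x0) : Sigma * X)).
Local Notation pastX := (borel ((past o, x0) : past_space M * X)).
Variable kappa : R.-pker (borel (past o)) ~> (borel o).

Definition fiber_incl (t : X) (w : borel o) : SX := (w, t).

Lemma measurable_fiber_incl t : measurable_fun setT (fiber_incl t).
Proof.
apply: (@continuous_measurable_borel Sigma (Sigma * X)%type o (o, x0)) => w.
apply: (@cvg_pair _ _ _ (nbhs w) (nbhs w) (nbhs t) (nbhs_filter _)
  (nbhs_filter _) (nbhs_filter _) id (fun=> t)); first exact: cvg_id.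
exact: cvg_cst.
Qed.

HB.instance Definition _ t :=
  isMeasurableFun.Build _ _ _ _ (fiber_incl t) (measurable_fiber_incl t).

Lemma measurable_pastX_fst : measurable_fun setT (fst : pastX -> borel (past o)).
Proof.
apply: (@continuous_measurable_borel (past_space M * X)%type (past_space M)
  (past o, x0) (past o) fst) => q.
exact: cvg_fst.
Qed.

Lemma measurable_pastX_snd : measurable_fun setT (snd : pastX -> borel x0).
Proof.
apply: (@continuous_measurable_borel (past_space M * X)%type X
  (past o, x0) x0 snd) => q.
exact: cvg_snd.
Qed.

(** The product of [kappa q.1] with the Dirac mass at [q.2]. As an image measure it lives on the
    Borel sets of the product topology, which [SX] carries. *)
Definition fiber_kernel (q : pastX) : {measure set SX -> \bar R} :=
  image_measure (kappa q.1) (fiber_incl q.2).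

Lemma fiber_kernel_box q C E :
  fiber_kernel q (C `*` E) = (kappa q.1 C * (\1_E q.2)%:E)%E.
Proof.
rewrite /fiber_kernel /= /image_measure /pushforward indicE.
have [Et|Et] := boolP (q.2 \in E).
  rewrite mule1; congr (kappa _ _); apply/seteqP; split => [w []//|w Cw].
  by split => //=; rewrite inE in Et.
rewrite mule0 (_ : _ @^-1` _ = set0) ?measure0//.
by apply/seteqP; split => // w [_ /=]; rewrite notin_setE in Et.
Qed.

Let measurable_fiber_kernel U : measurable U ->
  measurable_fun setT (fiber_kernel ^~ U).
Proof.
move=> mU; pose k := pker_comp kappa measurable_pastX_fst.
(* [fiber_kernel q U] is the [kappa q.1]-mass of the section at [q] of the preimage of [U] under
   [g]; sections of a measurable set have measurable mass under a finite kernel. *)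
pose g (z : pastX * borel o) : SX := (z.2, z.1.2).
have mg : measurable_fun setT g.
  apply: measurable_skew_boxes => n u w E oE.
  rewrite (_ : g @^-1` _ = (snd @^-1` E : set pastX) `*` two_sided_cylinder u w); last first.
    by apply/seteqP; split => [[q v] [/= Zv Eq]|[q v] [/= Eq Zv]].
  apply: measurableX.
    rewrite -[_ @^-1` _]setTI; apply: measurable_pastX_snd => //.
    exact: open_borel_measurable.
  by apply: open_borel_measurable; exact: open_two_sided_cylinder.
have mA : measurable (g @^-1` U) by rewrite -[_ @^-1` _]setTI; exact: mg.
have := @measurable_fun_xsection_finite_kernel _ _ _ _ _ k _ (mem_set mA).
congr measurable_fun; apply/funext => q; congr (kappa _ _).
by apply/seteqP; split => w; rewrite /xsection/= inE.
Qed.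

HB.instance Definition _ :=
  isKernel.Build _ _ _ _ R fiber_kernel measurable_fiber_kernel.

Let fiber_kernel_setT q : fiber_kernel q setT = 1%E.
Proof. by rewrite -setXTT fiber_kernel_box indicT mule1 prob_kernel. Qed.

HB.instance Definition _ :=
  Kernel_isProbability.Build _ _ _ _ R fiber_kernel fiber_kernel_setT.

(** Boxes are stable under intersection and generate, so the box identity suffices. Concentration is
    inherited from [kappa], whose exceptional set stays null because the base marginal of [nu] is
    [eta]. *)
Lemma future_disintegration (eta : probability (borel o) R)
    (nu : probability SX R) :
  is_disintegration eta (@base_past A M o) kappa ->
  (forall B : set (borel o), measurable B -> nu (fst @^-1` B) = eta B) ->
  (forall (C : set (borel o)) (E : set X), measurable C -> open E ->
    nu (C `*` E) = (\int[nu]_(x in setT `*` E) kappa (past x.1) C)%E) ->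
  is_disintegration nu (@past_fiber_proj R A M X o x0) fiber_kernel.
Proof.
move=> keta nu_base nu_box; split.
  pose G := [set B : set SX | exists (C : set (borel o)) (E : set X),
    [/\ measurable C, open E & B = C `*` E]].
  have GB B : G B -> measurable B.
    move=> [C [E [mC oE ->]]]; apply: measurable_box => //.
    exact: open_borel_measurable.
  move=> B mB; pose tau := distribution nu (@past_fiber_proj R A M X o x0).
  rewrite -[RHS](mixtureE tau fiber_kernel).
  apply: (@g_sigma_algebra_measure_unique _ _ SX G GB (fun=> setT) _ _ nu
    (mixture tau fiber_kernel)).
  - move=> _; exists setT, setT; split => //; first exact: openT.
    by rewrite setXTT.
  - by apply/seteqP; split => // x _; exists 0%N.
  - move=> _ _ [C [E [mC oE ->]]] [C' [E' [mC' oE' ->]]].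
    exists (C `&` C'), (E `&` E'); split; [exact: measurableI|exact: openI|].
    by rewrite setXI.
  - move=> _ [C [E [mC oE ->]]]; rewrite mixtureE.
    transitivity (\int[nu]_(x in setT `*` E) kappa (past x.1) C)%E.
      exact: nu_box.
    have mCE : measurable (C `*` E : set SX) by apply: GB; exists C, E.
    rewrite (ge0_integral_distribution (P := nu) (@past_fiber_proj R A M X o x0)
      (measurable_kernel fiber_kernel _ mCE))//.
    rewrite integral_mkcond; apply: eq_integral => x _.
    rewrite [RHS](fiber_kernel_box (past x.1, x.2) C E) /= patchE indicE.
    have -> : (x \in setT `*` E) = (x.2 \in E).
      by apply/idP/idP; rewrite !inE; [case|move=> ?; split].
    by case: (_ \in _); rewrite ?mule1 ?mule0.
  - by move=> _; rewrite (le_lt_trans (probability_le1 nu _)) ?ltry.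
  - have : measurable B := mB; apply: smallest_sub.
      exact: smallest_sigma_algebra.
    move=> V oV.
    apply: (smallest_sub (smallest_sigma_algebra setT G))
        (open_boxes (o := o) (x0 := x0) (E := @open X) _ oV).
      move=> _ [n [u [w [E [oE ->]]]]]; apply: sub_sigma_algebra.
      exists (two_sided_cylinder u w), E.
      by split => //; apply: open_borel_measurable; exact: open_two_sided_cylinder.
    move=> U oU; exists (fun=> U); split => //.
    by apply/seteqP; split => [x Ux|x [_ _]//]; exists 0%N.
have [_ [N [mN N0 NP]]] := keta.
exists (fst @^-1` N); split.
- by rewrite -[_ @^-1` _]setTI; exact: measurable_pastX_fst.
- have mpN := measurable_base_pastI mN.
  by rewrite -[RHS]N0 -[RHS]nu_base.
- move=> q /= nq; apply: NP => /= kq; apply: nq; rewrite -[RHS]kq.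
  rewrite /= /image_measure /pushforward; congr (kappa _ _).
  case: q {kq} => q t /=; apply/seteqP; split => w /=; rewrite /preimage /past_fiber_proj/=.
    by case.
  by move=> <-.
Qed.

End fiber_kernel.

(** * The entropy out of equilibrium *)

Section entropy_value.
Context (R : realType) (A : finType) (M : rel A) (X : metricType R).
Local Notation Sigma := (tms M).
Context (o : Sigma) (x0 : X) (F : Sigma -> X -> X).
Local Notation SX := (borel ((o, x0) : Sigma * X)).
Local Notation pastX := (borel ((past o, x0) : past_space M * X)).
Local Notation pfp := (@past_fiber_proj R A M X o x0).
Hypothesis cX : compact [set: X].
Hypothesis cF : continuous (fun z : Sigma * X => Defs.skew F z).
Hypothesis Fbij : forall w, bijective (F w).
Hypothesis Fpast : depends_on_past F.

Lemma past_fiber_proj_continuous :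
  continuous (fun x : Sigma * X => (past x.1, x.2)).
Proof.
move=> x; exact: (@cvg_pair _ _ _ (nbhs x) (nbhs (past x.1)) (nbhs x.2)
  (nbhs_filter x) (nbhs_filter _) (nbhs_filter _) _ _
  (@past_fst_continuous R A M X x) (@cvg_snd _ _ _ _ _)).
Qed.

Lemma past_fiber_hausdorff : hausdorff_space (past_space M * X)%type.
Proof.
by apply: pair_hausdorff; [exact: past_hausdorff|exact: metric_hausdorff].
Qed.

Lemma measurable_pastX_set1 (q : pastX) : measurable [set q].
Proof.
apply: closed_borel_measurable; apply: compact_closed; last exact: compact_set1.
exact: past_fiber_hausdorff.
Qed.

Lemma past_shift (x y : Sigma) : past (tms_shift x) = past (tms_shift y) <->
  symb x 0 = symb y 0 /\ past x = past y.
Proof.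
split=> [/past_eq xy|[xy0 /past_eq xy]].
  split; first exact: (xy 0%N).
  by apply/past_eq => i; have := xy i.+1; rewrite !symb_shift NegzS_add1.
by apply/past_eq => -[|i]; [exact: xy0|rewrite !symb_shift NegzS_add1].
Qed.

Lemma eq_fiber_map (x y : Sigma) : symb x 0 = symb y 0 -> past x = past y ->
  F x = F y.
Proof.
move=> xy0 /past_eq xy; apply: Fpast => -[[|//]|i] _; [exact: xy0|exact: xy].
Qed.

Lemma measurable_skew : measurable_fun setT (Defs.skew F : SX -> SX).
Proof. exact: (@continuous_measurable_borel _ _ (o, x0) (o, x0) _ cF). Qed.

Lemma measurable_symbol_partition a :
  measurable (symbol_partition a : set SX).
Proof.
apply: open_borel_measurable.
apply: (@open_comp _ _ (fst : Sigma * X -> Sigma)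
  [set x : Sigma | symb x 0 = a]); last exact: open_symb.
by move=> x _; exact: cvg_fst.
Qed.

Let pfp_skew_continuous : continuous (fun x : Sigma * X => pfp (Defs.skew F x)).
Proof.
move=> x; apply: (@continuous_comp (Sigma * X)%type (Sigma * X)%type
  (past_space M * X)%type (Defs.skew F) (fun x => (past x.1, x.2)) x).
  exact: cF.
exact: past_fiber_proj_continuous.
Qed.

Let forward_factor1 a : exists s : pastX -> pastX, measurable_fun setT s /\
  forall x : Sigma * X, symb x.1 0 = a -> s (pfp x) = pfp (Defs.skew F x).
Proof.
have cP : closed (symbol_partition a : set (Sigma * X)).
  apply: (@closed_comp _ _ (fst : Sigma * X -> Sigma)
    [set x : Sigma | symb x 0 = a]); last exact: closed_symb.
  by move=> x _; exact: cvg_fst.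
have h (x y : Sigma * X) : symbol_partition a x -> symbol_partition a y ->
    (past x.1, x.2) = (past y.1, y.2) ->
    pfp (Defs.skew F x) = pfp (Defs.skew F y).
  move=> xa ya e; have /= pxy := congr1 fst e; have /= txy := congr1 snd e.
  have xy0 : symb x.1 0 = symb y.1 0 by rewrite xa ya.
  rewrite /past_fiber_proj /Defs.skew /= txy (eq_fiber_map xy0 pxy).
  by have /past_shift -> : symb x.1 0 = symb y.1 0 /\ past x.1 = past y.1 by [].
have [s ms sE] := @measurable_factor _ _ _ (past o, x0) (past o, x0) _ _ _
  (skew_compact (M := M) cX) past_fiber_hausdorff past_fiber_proj_continuous
  pfp_skew_continuous cP h.
by exists s.
Qed.

Lemma forward_factor : exists s : A -> pastX -> pastX,
  (forall a, measurable_fun setT (s a)) /\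
  forall x : SX, pfp (Defs.skew F x) = s (symb x.1 0) (pfp x).
Proof.
have [s sP] := choice forward_factor1.
exists s; split=> [a|x]; first by have [] := sP a.
by have [_ sE] := sP (symb x.1 0); rewrite sE.
Qed.

(** The past of the shifted point contains the symbol at 0, hence determines the fiber map, whose
    injectivity recovers the fiber coordinate. *)
Lemma backward_factor : exists2 r : pastX -> pastX, measurable_fun setT r &
  forall x : SX, r (pfp (Defs.skew F x)) = pfp x.
Proof.
have h (x y : Sigma * X) : setT x -> setT y ->
    pfp (Defs.skew F x) = pfp (Defs.skew F y) ->
    (past x.1, x.2) = (past y.1, y.2).
  move=> _ _ e; have /= /past_shift[xy0 pxy] := congr1 fst e.
  have /= := congr1 snd e; rewrite (eq_fiber_map xy0 pxy) => Fxy.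
  by rewrite pxy (bij_inj (Fbij y.1) Fxy).
have [r mr rE] := @measurable_factor _ _ _ (past o, x0) (past o, x0) _ _ _
  (skew_compact (M := M) cX) past_fiber_hausdorff pfp_skew_continuous
  past_fiber_proj_continuous closedT h.
by exists r => // x; exact: rE.
Qed.

Lemma preimage_skew_past a (D : set pastX) : measurable D ->
  exists2 D' : set pastX, measurable D' &
    (symbol_partition a : set SX) `&` pfp @^-1` D =
    Defs.skew F @^-1` (pfp @^-1` D').
Proof.
move=> mD; have [r mr rE] := backward_factor.
(* After one shift the symbol at 0 is the most recent symbol of the past, which is where [D'] reads
   it. *)
exists ([set q : pastX | past_symb q.1 0%N = a] `&` r @^-1` D).
  apply: measurableI; last by rewrite -[_ @^-1` _]setTI; exact: mr.
  apply: open_borel_measurable.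
  apply: (@open_comp _ _ (fst : past_space M * X -> past_space M)
    [set q : past_space M | past_symb q 0%N = a]).
    by move=> x _; exact: cvg_fst.
  rewrite (_ : [set q | _] = past_cylinder [tuple a]).
    exact: open_past_cylinder.
  apply/seteqP; split => q; first by move=> <- i; rewrite ord1.
  by move=> /(_ ord0); rewrite (tnth_nth a).
apply/seteqP; split => x.
  by move=> [xa Dx]; split => //=; rewrite /preimage /= rE.
by move=> [xa]; rewrite /preimage /= rE => Dx; split.
Qed.

Section invariant_measure.
Variable m : probability SX R.
Hypothesis minv : skew_invariant F m.
Local Notation tau := (distribution m pfp).
Variable kappa : R.-pker pastX ~> SX.
Hypothesis km : is_disintegration m pfp kappa.

Local Notation join n :=
  (@partition_join _ _ (Defs.skew F) (@symbol_partition R A M X) n).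

Lemma measurable_join n (w : n.-tuple A) : measurable (join n w : set SX).
Proof.
exact: (measurable_partition_join measurable_skew measurable_symbol_partition).
Qed.

Definition one_step_entropy : \bar R :=
  (\int[tau]_q (partition_entropy (kappa q) (@symbol_partition R A M X))%:E)%E.

Lemma integral_join_entropy n :
  (\int[tau]_q (partition_entropy (kappa q) (join n))%:E =
   n%:R%:E * one_step_entropy)%E.
Proof.
have [s [ms sE]] := forward_factor.
exact: (@integral_partition_entropy _ _ _ _ _ A m pfp kappa km measurable_pastX_set1
  (Defs.skew F) measurable_skew minv (fun x => symb x.1 0)
  measurable_symbol_partition s ms sE preimage_skew_past n).
Qed.

Lemma entropy_limit : limn_esup (fun n : nat => \int[tau]_q
      (n%:R^-1 * partition_entropy (kappa q) (join n))%:E)%E = one_step_entropy.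
Proof.
have cvg1 : (fun n : nat => \int[tau]_q
    (n%:R^-1 * partition_entropy (kappa q) (join n))%:E)%E @ \oo -->
    one_step_entropy.
  (* The sequence is constant from [n = 1] on; the term [n = 0] is excluded since [0^-1] is 0. *)
  apply: cvg_near_cst; exists 1%N => // n /= n1.
  under eq_integral do rewrite EFinM.
  rewrite ge0_integralZl//.
  - rewrite integral_join_entropy muleA -EFinM mulVf ?mul1e//.
    by rewrite pnatr_eq0 -lt0n.
  - apply/measurable_EFinP/measurable_partition_entropy => w.
    exact: measurable_join.
  - move=> q _; rewrite lee_fin; apply: partition_entropy_ge0 => w.
    exact: measurable_join.
by rewrite is_cvg_limn_esupE; [exact/cvg_lim|apply/cvg_ex; exists one_step_entropy].
Qed.

End invariant_measure.

(** [entropy_ooe] selects an unspecified disintegration. Only the finitely many masses of symbol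
    sets enter here, so uniqueness set by set is enough. *)
Lemma one_step_entropy_unique (m : probability SX R)
    (kappa kappa' : R.-pker pastX ~> SX) :
  is_disintegration m pfp kappa -> is_disintegration m pfp kappa' ->
  one_step_entropy m kappa = one_step_entropy m kappa'.
Proof.
move=> km km'; apply: ae_eq_integral => //.
- apply/measurable_EFinP/measurable_partition_entropy.
  exact: measurable_symbol_partition.
- apply/measurable_EFinP/measurable_partition_entropy.
  exact: measurable_symbol_partition.
have : {ae distribution m pfp, forall q, forall a : A,
    kappa q (symbol_partition a) = kappa' q (symbol_partition a)}.
  apply: filter_forall => a; apply: (disintegration_ae_eq km') => //.
  - exact: measurable_pastX_set1.
  - exact: measurable_symbol_partition.
  - exact: (measurable_kernel kappa _ (measurable_symbol_partition a)).
  - move=> D mD; rewrite (disintegration_setI km)//.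
      exact: measurable_pastX_set1.
    exact: measurable_symbol_partition.
apply: filterS => q kk _; rewrite /partition_entropy.
by congr (- _)%:E; apply: eq_bigr => a _; rewrite kk.
Qed.

Lemma entropy_ooeE (m : probability SX R) (kappa : R.-pker pastX ~> SX) :
  skew_invariant F m -> is_disintegration m pfp kappa ->
  entropy_ooe F m = one_step_entropy m kappa.
Proof.
move=> minv km; rewrite /entropy_ooe; case: xgetP => [h _ [k' km' ->]|none].
  by rewrite (entropy_limit minv km'); exact: one_step_entropy_unique.
exfalso; apply: none; exists kappa; first exact: km.
by [].
Qed.

(** The default value of [xget] serves as a test: an entropy other than [-oo] certifies that some
    disintegration was found. *)
Lemma entropy_ooe_disintegration (m : probability SX R) :
  entropy_ooe F m != -oo%E ->
  exists kappa : R.-pker pastX ~> SX, is_disintegration m pfp kappa.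
Proof.
rewrite /entropy_ooe; case: xgetP => [h _ [k km _]|_]; first by exists k.
by rewrite eqxx.
Qed.

End entropy_value.

(** * Conditional independence and product measures *)

(** Lists of indices code finite intersections of a countable base: concatenation gives stability
    under intersection, the empty list the whole space. The code [None] is the empty set, which pads
    countable unions. *)
Lemma compact_metric_base (R : realType) (X : metricType R) (x0 : X) :
  compact [set: X] -> exists e : nat -> set X,
  [/\ forall n, open (e n), exists n, e n = setT,
      forall i j, exists k, e i `&` e j = e k &
      forall U : set X, open U -> exists G : nat -> set X,
        (forall n, range e (G n)) /\ U = \bigcup_n G n].
Proof.
move=> cX.
pose Xp : pseudoPMetricType R := HB.pack X (isPointed.Build X x0).
have [B cB [Bo Bb]] := @compact_second_countable R Xp cX.
have [b bB] : exists b : nat -> set X, range b = B.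
  have /pfcard_geP[B0|[f]] := cB.
    have [V [BV _] _] := Bb x0 setT filterT.
    by exfalso; move: BV; rewrite B0.
  by exists f; exact: image_eq.
pose I (s : seq nat) : set X := foldr (fun i U => b i `&` U) setT s.
pose e n := if unpickle n is Some (Some s) then I s else set0.
have eI s : e (pickle (Some s)) = I s by rewrite /e pickleK.
have oI s : open (I s).
  elim: s => [|i s IH] /=; first exact: openT.
  by apply: openI => //; apply: Bo; rewrite -bB; exists i.
have Icat s t : I s `&` I t = I (s ++ t).
  by elim: s => [|i s IH] /=; rewrite ?setTI// -setIA IH.
exists e; split.
- move=> n; rewrite /e; case: (unpickle n) => [[s|]|]; first exact: oI.
    exact: open0.
  exact: open0.
- by exists (pickle (Some ([::] : seq nat))); rewrite eI.
- move=> i j; rewrite {1 2}/e.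
  case: (unpickle i) => [[s|]|]; last 2 first.
  + by exists (pickle (@None (seq nat))); rewrite set0I /e pickleK.
  + by exists (pickle (@None (seq nat))); rewrite set0I /e pickleK.
  case: (unpickle j) => [[t|]|].
  + by exists (pickle (Some (s ++ t))); rewrite eI Icat.
  + by exists (pickle (@None (seq nat))); rewrite setI0 /e pickleK.
  + by exists (pickle (@None (seq nat))); rewrite setI0 /e pickleK.
- move=> U oU.
  exists (fun n => if `[< b n `<=` U >] then b n else set0); split.
    move=> n; case: ifPn => _.
      by exists (pickle (Some ([:: n] : seq nat))) => //; rewrite eI /= setIT.
    by exists (pickle (@None (seq nat))) => //; rewrite /e pickleK.
  apply/seteqP; split => [x Ux|x [n _]]; last first.
    by case: ifPn => [/asboolP bU /bU|].
  have [V [BV Vx] VU] := Bb x U (open_nbhs_nbhs (conj oU Ux)).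
  move: BV; rewrite -bB => -[n _ bn]; exists n => //.
  by rewrite bn asboolT.
Qed.

Lemma ae_forall_countable d (T : measurableType d) (R : realType)
    (m : {measure set T -> \bar R}) (I : countType) (P : I -> T -> Prop) :
  (forall i, {ae m, forall x, P i x}) -> {ae m, forall x, forall i, P i x}.
Proof.
move=> mP; pose N n : set T :=
  if unpickle n is Some i then ~` [set x | P i x] else set0.
have : m.-negligible (\bigcup_n N n).
  apply: negligible_bigcup => n; rewrite /N; case: (unpickle n) => [i|].
    exact: mP.
  exact: negligible_set0.
apply: negligibleS => x /= /existsNP[i Pi].
by exists (pickle i) => //; rewrite /N pickleK.
Qed.

Section cylinder_intersection.
Context (A : finType) (M : rel A).

Lemma two_sided_cylinder_nested n n' (u w : n.-tuple A) (u' w' : n'.-tuple A)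
    (x : tms M) : (n <= n')%N ->
  two_sided_cylinder u w x -> two_sided_cylinder u' w' x ->
  two_sided_cylinder u w `&` two_sided_cylinder u' w' =
  two_sided_cylinder u' w' :> set (tms M).
Proof.
move=> nn' [xw xu] [xw' xu']; apply/seteqP; split => [y []//|y].
move=> [yw' yu']; split => //; split => i.
  have i' : (i < n')%N := leq_trans (ltn_ord i) nn'.
  have := yw' (Ordinal i'); rewrite -(xw' (Ordinal i')) /= => ->.
  exact: xw.
have i' : (i < n')%N := leq_trans (ltn_ord i) nn'.
have := yu' (Ordinal i'); rewrite -(xu' (Ordinal i')) /= => ->.
exact: xu.
Qed.

End cylinder_intersection.

Section conditional_product.
Context (R : realType) (A : finType) (M : rel A) (X : metricType R).
Local Notation Sigma := (tms M).
Context (o : Sigma) (x0 : X).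
Local Notation SX := (borel ((o, x0) : Sigma * X)).
Local Notation pastX := (borel ((past o, x0) : past_space M * X)).
Local Notation pfp := (@past_fiber_proj R A M X o x0).
Local Notation pproj := (@past_proj R A M X o x0).
Hypothesis cX : compact [set: X].
Variable mu : probability SX R.
Let eta := distribution mu (@base_proj R A M X o x0).
Variable kappahat : R.-pker (borel (past o)) ~> SX.
Variable kappa : R.-pker (borel (past o)) ~> (borel o).
Variable kappam : R.-pker pastX ~> SX.
Hypothesis khat : is_disintegration mu pproj kappahat.
Hypothesis keta : is_disintegration eta (@base_past A M o) kappa.
Hypothesis km : is_disintegration mu pfp kappam.
Hypothesis indep : forall n (w : n.-tuple A), {ae distribution mu pfp,
  forall q, kappam q (cylinder w `*` setT) = kappa q.1 (cylinder w)}.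

Let mcyl n (w : n.-tuple A) : measurable (@cylinder A M n w : set (borel o)).
Proof. by apply: closed_borel_measurable; exact: closed_cylinder. Qed.

(** Tower property: conditioning on past and fiber coordinate, [indep] replaces the mass of the
    cylinder by [kappa q.1], which depends on the past alone and so leaves the coarser conditioning
    as a factor. *)
Lemma fiber_rectangle n (w : n.-tuple A) (E : set X) : open E ->
  {ae distribution mu pproj, forall q,
    (kappa q (cylinder w) * kappahat q (setT `*` E))%E =
    kappahat q (cylinder w `*` E)}.
Proof.
move=> oE; have mE : measurable (E : set (borel x0)).
  exact: open_borel_measurable.
have mTE : measurable (setT `*` E : set SX) by exact: measurable_box.
have mCE : measurable (cylinder w `*` E : set SX) by exact: measurable_box.
have mCT : measurable (cylinder w `*` setT : set SX) by exact: measurable_box.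
have mk := measurable_kernel kappa _ (mcyl w).
apply: (disintegration_ae_eq khat) => //.
- exact: measurable_past_set1.
- by apply: emeasurable_funM => //; exact: (measurable_kernel kappahat _ mTE).
move=> D mD; pose h := (fun q => kappa q (cylinder w)) \_ D.
have mh : measurable_fun setT h.
  by apply/(measurable_restrictT _ _).1 => //; exact: measurable_funTS.
have h0 q : (0 <= h q)%E by rewrite erestrict_ge0.
transitivity (\int[distribution mu pproj]_q (h q * kappahat q (setT `*` E)))%E.
  rewrite integral_mkcond; apply: eq_integral => q _.
  by rewrite /h !patchE; case: ifPn => _; rewrite ?mul0e.
rewrite -(disintegration_integral_setI khat)//; last exact: measurable_past_set1.
pose DE : set pastX := [set q | D q.1 /\ E q.2].
have mDE : measurable DE.
  apply: (@measurableI _ pastX (fst @^-1` D) (snd @^-1` E)).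
    by rewrite -[_ @^-1` _]setTI; exact: measurable_pastX_fst.
  by rewrite -[_ @^-1` _]setTI; exact: measurable_pastX_snd.
transitivity (\int[mu]_(x in pfp @^-1` DE) kappa (pfp x).1 (cylinder w))%E.
  rewrite integral_mkcond [RHS]integral_mkcond; apply: eq_integral => x _.
  rewrite /patch /h /patch /past_proj.
  have -> : (x \in pfp @^-1` DE) = (x \in setT `*` E) && (past x.1 \in D).
    by apply/idP/andP; rewrite !inE /DE /preimage /=; [case|case => -[]].
  by case: (x \in setT `*` E) => //=; case: (past x.1 \in D).
have mk1 : measurable_fun DE (fun q : pastX => kappa q.1 (cylinder w)).
  by apply: measurable_funTS; exact: (measurableT_comp mk (@measurable_pastX_fst R A M X o x0)).
rewrite -(ge0_integral_pushforward (measurable_funPT pfp) mu mDE mk1); last by [].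
transitivity (\int[distribution mu pfp]_(q in DE) kappam q (cylinder w `*` setT))%E.
  apply: ae_eq_integral => //.
  - exact: measurable_funTS (measurable_kernel kappam _ mCT).
  - by move: (indep w); apply: filterS => q -> _.
rewrite -(disintegration_setI km)//; last exact: measurable_pastX_set1.
congr (mu _); apply/seteqP; split => [[x t]|[x t]].
  by move=> [[Cx _] [Dx Et]].
by move=> [[Cx Et] Dx].
Qed.

(** The identity, from the product sigma-algebra, on which product measures live, to the Borel
    sigma-algebra of the product topology. *)
Definition borel_pair (z : borel o * borel x0) : SX := (z.1, z.2).

Lemma measurable_borel_pair : measurable_fun setT borel_pair.
Proof.
apply: measurable_skew_boxes => n u w E oE.
rewrite (_ : _ @^-1` _ = two_sided_cylinder u w `*` E); last first.
  by apply/seteqP; split => [[x t]|[x t]].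
apply: measurableX; last exact: open_borel_measurable.
by apply: open_borel_measurable; exact: open_two_sided_cylinder.
Qed.

HB.instance Definition _ :=
  isMeasurableFun.Build _ _ _ _ borel_pair measurable_borel_pair.

Definition fiber_coord (x : SX) : borel x0 := x.2.

Lemma measurable_fiber_coord : measurable_fun setT fiber_coord.
Proof.
apply: (@continuous_measurable_borel (Sigma * X)%type X (o, x0) x0 snd) => q.
exact: cvg_snd.
Qed.

HB.instance Definition _ :=
  isMeasurableFun.Build _ _ _ _ fiber_coord measurable_fiber_coord.

(** Only countably many exceptional sets can be united, hence words and a countable base; stability
    of the latter under intersection lets its boxes determine a probability. *)
Lemma conditional_product :
  {ae distribution eta (@base_past A M o), forall w,
    exists sigma : probability (borel x0) R, forall B : set SX,
      measurable B -> kappahat w B = (kappa w \x sigma)%E B}.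
Proof.
have [e [oe [nT eT] eI eU]] := compact_metric_base x0 cX.
have me n : measurable (e n : set (borel x0)) by exact: open_borel_measurable.
have H1 : {ae distribution mu pproj, forall q,
    forall i : {n : nat & n.-tuple A} * nat,
    (kappa q (cylinder (tagged i.1)) * kappahat q (setT `*` e i.2))%E =
    kappahat q (cylinder (tagged i.1) `*` e i.2)}.
  by apply: ae_forall_countable => i; exact: fiber_rectangle.
have H2 := disintegration_fiberI khat (@measurable_past_set1 A M o).
have H3 : {ae distribution mu pproj, forall q, forall C D, measurable C ->
    measurable D -> kappa q (C `&` (@base_past A M o) @^-1` D) =
    (kappa q C * (\1_D q)%:E)%E}.
  exact: (disintegration_fiberI keta (@measurable_past_set1 A M o)).
suff : {ae distribution mu pproj, forall w,
    exists sigma : probability (borel x0) R, forall B : set SX,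
      measurable B -> kappahat w B = (kappa w \x sigma)%E B} by [].
move: H1 H2 H3; apply: filterS3 => q H1 H2 H3.
(* The only candidate for the second factor is the fiber marginal of [kappahat q]. *)
pose sigma : probability (borel x0) R :=
  distribution (pker_prob kappahat q) fiber_coord.
exists sigma => B mB.
pose m2 : {measure set SX -> \bar R} := image_measure (kappa q \x sigma)%E borel_pair.
have -> : (kappa q \x sigma)%E B = m2 B.
  rewrite /m2 /= /image_measure /pushforward.
  by rewrite (_ : borel_pair @^-1` B = B)//; apply/seteqP; split => -[].
have sigmaE E : sigma E = kappahat q (setT `*` E).
  rewrite /sigma /distribution /pushforward /=; congr (kappahat q _).
  by apply/seteqP; split => [[x t]|[x t] []].
have m2_box : forall (C : set (borel o)) (E : set (borel x0)), measurable C ->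
    measurable E -> m2 (C `*` E) = (kappa q C * kappahat q (setT `*` E))%E.
  by move=> C E mC mE; rewrite -sigmaE -product_measure1E.
pose G := [set B : set SX | B = set0 \/ boxes (o := o) (x0 := x0) (range e) B].
have eU' (U : set X) : open U -> exists G0 : nat -> set X,
    (forall n, range e (G0 n)) /\ U = \bigcup_n G0 n by exact: eU.
have Gm : G `<=` (measurable : set (set SX)).
  move=> _ [->//|[n [u [w [_ [[i _ <-] ->]]]]]].
  apply: measurable_box => //; apply: open_borel_measurable.
  exact: open_two_sided_cylinder.
apply: (@g_sigma_algebra_measure_unique _ _ SX G Gm (fun=> setT) _ _
  (pker_prob kappahat q) m2).
- move=> _; right; exists 0%N, [tuple], [tuple], setT; split.
    by exists nT.
  apply/seteqP; split => // -[x t] _; split => //=.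
  by split => -[].
- by apply/seteqP; split => // x _; exists 0%N.
- move=> D D' [->|[n [u [w [_ [[i _ <-] ->]]]]]]; first by left; rewrite set0I.
  case=> [->|[n' [u' [w' [_ [[j _ <-] ->]]]]]]; first by left; rewrite setI0.
  rewrite -setXI; have [k eij] := eI i j.
  have [->|/set0P[x [xu xu']]] :=
      eqVneq (two_sided_cylinder u w `&` two_sided_cylinder u' w' : set Sigma) set0.
    by left; rewrite set0X.
  right; have [nn'|n'n] := leqP n n'.
    exists n', u', w', (e k); split; first by exists k.
    by rewrite (two_sided_cylinder_nested nn' xu xu') eij.
  exists n, u, w, (e k); split; first by exists k.
  by rewrite setIC (two_sided_cylinder_nested (ltnW n'n) xu' xu) eij.
- move=> _ [->|[n [u [w [_ [[i _ <-] ->]]]]]]; first by rewrite !measure0.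
  have mpu : measurable (past_cylinder u : set (borel (past o))).
    by apply: open_borel_measurable; exact: open_past_cylinder.
  have mw := mcyl w.
  (* The past half of the cylinder is a preimage under the projection, so it contributes the same
     factor 0 or 1 to both measures; the future half is [fiber_rectangle]. *)
  have -> : two_sided_cylinder u w `*` e i = (cylinder w `*` e i : set SX) `&`
      pproj @^-1` (past_cylinder u).
    by apply/seteqP; split => [[x t] [[/= xw xu] et]|[x t] [[/= xw et] xu]].
  rewrite [LHS]H2//; last exact: measurable_box.
  rewrite -(H1 (Tagged (fun n => n.-tuple A) w, i)) /=.
  have -> : (cylinder w `*` e i : set SX) `&` pproj @^-1` (past_cylinder u) =
      (cylinder w `&` (@base_past A M o) @^-1` past_cylinder u) `*` e i.
    by apply/seteqP; split => [[x t] [[/= xw xu] et]|[x t] [[/= xw et] xu]].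
  rewrite m2_box//; last first.
    by apply: measurableI => //; exact: measurable_base_pastI.
  by rewrite H3// muleAC.
- by move=> _; rewrite (le_lt_trans (probability_le1 _ _)) ?ltry.
- have : measurable B := mB; apply: smallest_sub.
    exact: smallest_sigma_algebra.
  move=> V oV; apply: (smallest_sub (smallest_sigma_algebra setT G))
        (open_boxes (o := o) (x0 := x0) eU' oV).
  by move=> D bD; apply: sub_sigma_algebra; right.
Qed.

End conditional_product.

Section markov_cylinders.
Context (R : realType) (A : finType) (M : rel A) (X : metricType R).
Local Notation Sigma := (tms M).

Lemma symb_iter_shift (x : Sigma) n (i : int) :
  symb (iter n tms_shift x) i = symb x (i + n%:Z).
Proof.
elim: n i => [|n IH] i /=; first by rewrite addr0.
by rewrite symb_shift IH -addrA -[1]/(1%:Z) -PoszD add1n.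
Qed.

Definition word n (x : Sigma) : n.-tuple A := [tuple symb x (i : nat)%:Z | i < n].

Lemma word_fiber n (w : n.-tuple A) : [set x | word n x = w] = cylinder w.
Proof.
apply/seteqP; split => [x /= <- i|x xw]; first by rewrite tnth_mktuple.
by apply: eq_from_tnth => i; rewrite tnth_mktuple; exact: xw.
Qed.

Lemma partition_join_cylinder (F : Sigma -> X -> X) n (w : n.-tuple A) :
  partition_join (Defs.skew F) (@symbol_partition R A M X) w =
  cylinder w `*` setT.
Proof.
apply/seteqP; split => [x xw|x [xw _] i _].
  by split => // i; rewrite -(xw i Logic.I) iter_skew1 symb_iter_shift add0r.
rewrite /preimage /symbol_partition /= iter_skew1 symb_iter_shift add0r.
exact: xw.
Qed.

End markov_cylinders.

(** * Measures of maximal free energy *)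

Section maximal_measure.
Context (R : realType) (A : finType) (M : rel A) (X : metricType R).
Local Notation Sigma := (tms M).
Context (o : Sigma) (x0 : X).
Local Notation SX := (borel ((o, x0) : Sigma * X)).
Local Notation pastX := (borel ((past o, x0) : past_space M * X)).
Local Notation pfp := (@past_fiber_proj R A M X o x0).
Local Notation base := (@base_proj R A M X o x0).

Lemma integral_base (m : probability SX R) (C : set (borel o))
    (f : borel o -> \bar R) : measurable C -> measurable_fun setT f ->
  (forall x, 0 <= f x)%E ->
  (\int[m]_(x in C `*` setT) f x.1 = \int[distribution m base]_(x in C) f x)%E.
Proof.
move=> mC mf f0.
have -> : C `*` setT = base @^-1` C by apply/seteqP; split => x //= [].
rewrite (ge0_integral_pushforward (measurable_funPT base) m mC)//.
exact: measurable_funTS.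
Qed.

Lemma integral_past (m : probability SX R) (f : borel (past o) -> \bar R) :
  measurable_fun setT f -> (forall w, 0 <= f w)%E ->
  (\int[distribution m pfp]_q f q.1 =
   \int[distribution m base]_x f (past x))%E.
Proof.
move=> mf f0.
have mfst : measurable_fun setT (fun q : pastX => f q.1).
  exact: (measurableT_comp mf (@measurable_pastX_fst R A M X o x0)).
rewrite (ge0_integral_distribution (P := m) pfp mfst)//.
rewrite -integral_base//.
  by rewrite setXTT.
exact: (measurableT_comp mf (@measurable_base_past A M o)).
Qed.

Section independence.
Variables (F : Sigma -> X -> X) (mu nu : probability SX R).
Local Notation eta := (distribution mu base).
Variable kappa : R.-pker (borel (past o)) ~> (borel o).
Variable kappam : R.-pker pastX ~> SX.
Hypothesis keta : is_disintegration eta (@base_past A M o) kappa.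
Hypothesis km : is_disintegration mu pfp kappam.
Hypothesis nu_base : forall B : set (borel o), measurable B ->
  distribution nu base B = eta B.
Hypothesis entropy_le : forall n,
  (\int[distribution nu pfp]_q (partition_entropy
     (@fiber_kernel R A M X o x0 kappa q)
     (fun w : n.-tuple A => partition_join (Defs.skew F) (@symbol_partition R A M X) w))%:E <=
   \int[distribution mu pfp]_q (partition_entropy (kappam q)
     (fun w : n.-tuple A => partition_join (Defs.skew F) (@symbol_partition R A M X) w))%:E)%E.

(** [g] is conditioned on past and fiber coordinate, [k] on the past alone. Averaged over the fiber
    coordinate [g] becomes [k], so a function of [k] integrates alike against both, which is the
    cross entropy hypothesis of [gibbs_eq]. *)
Lemma future_conditional n (w : n.-tuple A) : {ae distribution mu pfp,
  forall q, kappam q (cylinder w `*` setT) = kappa q.1 (cylinder w)}.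
Proof.
have mcyl (v : n.-tuple A) : measurable (cylinder v : set (borel o)).
  by apply: closed_borel_measurable; exact: closed_cylinder.
have mcylT (v : n.-tuple A) : measurable (cylinder v `*` setT : set SX).
  by apply: measurable_box.
pose g (v : n.-tuple A) (q : pastX) := fine (kappam q (cylinder v `*` setT)).
pose k0 (v : n.-tuple A) (q : borel (past o)) := fine (kappa q (cylinder v)).
pose k (v : n.-tuple A) (q : pastX) := k0 v q.1.
have mk0 v : measurable_fun setT (k0 v).
  by apply: measurableT_comp => //; exact: measurable_kernel.
have mk v : measurable_fun setT (k v).
  exact: (measurableT_comp (mk0 v) (@measurable_pastX_fst R A M X o x0)).
have k0b v q : 0 <= k0 v q <= 1 by exact: pker_fine_bounds.
have kE v q : (k0 v q)%:E = kappa q (cylinder v).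
  by rewrite fineK//; exact: pker_fin_num.
have gE v q : (g v q)%:E = kappam q (cylinder v `*` setT).
  by rewrite fineK//; exact: pker_fin_num.
have cylT v : [set x : SX | word n x.1 = v] = cylinder v `*` setT.
  apply/seteqP; split => x /=; rewrite -word_fiber; first by [].
  by case.
suff : {ae distribution mu pfp, forall q, forall v, g v q = k v q}.
  by apply: filterS => q gk; rewrite -gE gk kE.
apply: gibbs_eq.
- by move=> v; apply: measurableT_comp => //; exact: measurable_kernel.
- exact: mk.
- by move=> v q; exact: pker_fine_bounds.
- by move=> v q; exact: k0b.
- move=> q; rewrite -[RHS](pker_sum_fibers kappam q (l := fun x => word n x.1)).
    by apply: eq_bigr => v _; congr (fine (kappam q _)); exact/esym/cylT.
  by move=> v; rewrite cylT.
- move=> q; rewrite -[RHS](pker_sum_fibers kappa q.1 (l := @word A M n)).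
    by apply: eq_bigr => v _; congr (fine (kappa q.1 _)); exact/esym/word_fiber.
  by move=> v; rewrite word_fiber.
- move=> v h mh h0.
  pose hk q := (h (k0 v q))%:E.
  have mhk : measurable_fun setT hk.
    by apply/measurable_EFinP; exact: (measurableT_comp mh (mk0 v)).
  have hk0 q : (0 <= hk q)%E by rewrite lee_fin h0.
  have mhk1 : measurable_fun setT (fun q : pastX => hk q.1).
    exact: (measurableT_comp mhk (@measurable_pastX_fst R A M X o x0)).
  have mhkk : measurable_fun setT (fun q => hk q * (k0 v q)%:E)%E.
    by apply: emeasurable_funM => //; exact/measurable_EFinP.
  transitivity (\int[distribution mu pfp]_q (hk q.1 * kappam q (cylinder v `*` setT)))%E.
    by apply: eq_integral => q _; rewrite EFinM gE.
  rewrite -(disintegration_integral_setI km (@measurable_pastX_set1 R A M X o x0) (mcylT v) mhk1)//.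
  rewrite (@integral_base mu _ (fun x => hk (past x)))//; last first.
    exact: (measurableT_comp mhk (@measurable_base_past A M o)).
  transitivity (\int[distribution eta (@base_past A M o)]_q (hk q * kappa q (cylinder v)))%E.
    exact: (disintegration_integral_setI keta (@measurable_past_set1 A M o) (mcyl v) mhk).
  transitivity (\int[distribution eta (@base_past A M o)]_q (hk q * (k0 v q)%:E))%E.
    by apply: eq_integral => q _; rewrite kE.
  rewrite (ge0_integral_distribution (P := eta) (@base_past A M o) mhkk); last first.
    by move=> q; rewrite mule_ge0// lee_fin; case/andP: (k0b v q).
  rewrite -(@integral_past mu (fun q => hk q * (k0 v q)%:E)%E mhkk)//.
  by move=> q; rewrite mule_ge0// lee_fin; case/andP: (k0b v q).
have mH : measurable_fun setT
    (fun q : borel (past o) => (- \sum_v k0 v q * ln (k0 v q))%:E).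
  apply/measurable_EFinP; apply: measurableT_comp => //.
  apply: measurable_sum => v; apply: measurable_funM => //.
  by apply: measurableT_comp => //; exact: mk0.
have H0 q : (0 <= (- \sum_v k0 v q * ln (k0 v q))%:E)%E.
  by rewrite lee_fin oppr_ge0 sumr_le0// => v _; exact: mulr_ln_le0.
have joinE (v : n.-tuple A) : partition_join (Defs.skew F) (@symbol_partition R A M X) v =
    cylinder v `*` setT by exact: partition_join_cylinder.
(* Both integrands read the past only, and [mu] and [nu] have the same base marginal. *)
have -> : (\int[distribution mu pfp]_q (- \sum_v k v q * ln (k v q))%:E =
    \int[distribution nu pfp]_q (partition_entropy
     (@fiber_kernel R A M X o x0 kappa q)
     (fun w : n.-tuple A => partition_join (Defs.skew F) (@symbol_partition R A M X) w))%:E)%E.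
  rewrite (@integral_past mu _ mH H0).
  transitivity (\int[distribution nu base]_x (- \sum_v k0 v (past x) * ln (k0 v (past x)))%:E)%E.
    by apply: eq_measure_integral => B mB _; exact: esym (nu_base mB).
  rewrite -(@integral_past nu _ mH H0); apply: eq_integral => q _.
  congr (- _)%:E; apply: eq_bigr => v _.
  rewrite joinE (_ : fiber_kernel kappa q _ = kappa q.1 (cylinder v))//.
  by rewrite fiber_kernel_box indicT mule1.
apply: le_trans (entropy_le n) _; rewrite le_eqVlt; apply/orP; left; apply/eqP.
by apply: eq_integral => q _; congr (- _)%:E; apply: eq_bigr => v _; rewrite joinE.
Qed.

End independence.
Lemma measurable_potential (phi : Sigma -> R) : continuous phi ->
  measurable_fun setT (phi : borel o -> R).
Proof.
move=> /continuousP cphi; apply: (measurability (@RGenOInfty.G R)).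
  exact: RGenOInfty.measurableE.
move=> _ [_ [y ->] <-]; rewrite setTI; apply: open_borel_measurable.
by apply: cphi; exact: interval_open.
Qed.

Lemma integrable_potential (m : probability SX R) (phi : Sigma -> R) :
  continuous phi -> m.-integrable setT (fun x => (phi x.1)%:E).
Proof.
move=> cphi; apply: (@measurable_bounded_integrable _ _ _ m (fun x => phi x.1)) => //.
- by rewrite (le_lt_trans (probability_le1 _ _)) ?ltry.
- exact: (measurableT_comp (measurable_potential cphi) (measurable_funPT base)).
have /compact_bounded[r [rr rb]] : compact (phi @` setT).
  by apply: continuous_compact; [exact: continuous_subspaceT|exact: tms_compact].
by exists r; split => // s rs x _; apply: rb => //; exists x.1.
Qed.

Lemma integral_potential (m : probability SX R) (phi : Sigma -> R) :
  continuous phi ->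
  (\int[m]_x (phi x.1)%:E = \int[distribution m base]_x (phi x)%:E)%E.
Proof.
move=> cphi; symmetry; apply: (@integral_distribution _ _ _ _ _ m base (EFin \o phi)).
  by apply/measurable_EFinP; exact: measurable_potential.
exact: integrable_potential.
Qed.

End maximal_measure.

Theorem theorem7p1 (R : realType) (A : finType) (M : rel A) (X : metricType R)
    (o : tms M) (x0 : X) (alpha : R) (F : tms M -> X -> X)
    (phihat : tms M * X -> R) (phi : tms M -> R) :
  topologically_transitive (@tms_shift A M) ->
  compact [set: X] ->
  0 < alpha <= 1 ->
  (forall w, holder (@mdist R X) (@mdist R X) alpha (F w)) ->
  (forall w, homeomorphism (F w)) ->
  holder_continuous (@shift_dist A M R) (@unif_dist R X) F ->
  holder_continuous (@skew_dist R A M X) (fun a b : R => `|a - b|) phihat ->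
  has_holonomies F phihat ->
  depends_on_past F ->
  (forall w t, phihat (w, t) = phi w) ->
  poe o F phihat = pressure phi /\
  forall mu : probability (borel ((o, x0) : tms M * X)) R,
    attains_max F phihat mu -> future_independent mu.
Proof.
move=> _ cX _ _ Fhomeo hF hphi _ Fpast phihatE.
have cphi : continuous phi.
  exact: (@base_potential_continuous _ _ _ _ phi phihat x0 hphi phihatE).
split; first exact: poe_base.
move=> mu [mu_inv mu_max] eta eta_past kappahat kappa khat keta.
have cF : continuous (fun z : tms M * X => Defs.skew F z).
  by apply: skew_continuous => // w; case: (Fhomeo w).
have Fbij w : bijective (F w).
  by have [_ [g [_ gK Kg]]] := Fhomeo w; exists g.
have eta_shift (B : set (borel o)) : measurable B -> eta (tms_shift @^-1` B) = eta B.
  move=> mB; apply: (mu_inv (@base_proj R A M X o x0 @^-1` B)).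
  by rewrite -[_ @^-1` _]setTI; exact: measurable_funPT.
pose nu : probability (borel ((o, x0) : tms M * X)) R :=
  comparison (x0 := x0) cX cF eta.
have nu_inv : skew_invariant F nu by exact: comparison_invariant.
have nu_base (B : set (borel o)) : measurable B ->
    distribution nu (@base_proj R A M X o x0) B = eta B.
  by move=> mB; exact: comparison_base.
have knu : is_disintegration nu (@past_fiber_proj R A M X o x0)
    (@fiber_kernel R A M X o x0 kappa).
  apply: (future_disintegration keta) => //.
  by move=> C E mC oE; exact: comparison_integral.
have entropy_nu := entropy_ooeE cX cF Fbij Fpast nu_inv knu.
have nu_mu : (entropy_ooe F nu <= entropy_ooe F mu)%E.
  have potential (m : probability (borel ((o, x0) : tms M * X)) R) :
      (\int[m]_x (phihat x)%:E = \int[m]_x (phi x.1)%:E)%E.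
    by apply: eq_integral => -[x t] _; rewrite phihatE.
  have := mu_max nu nu_inv; rewrite /free_energy !potential.
  have -> : (\int[nu]_x (phi x.1)%:E = \int[mu]_x (phi x.1)%:E)%E.
    rewrite !integral_potential//; apply: eq_measure_integral => B mB _.
    exact: nu_base.
  (* The potential can be cancelled because its integral is finite, [phi] being continuous on a
     compact space. *)
  rewrite leeD2rE//; apply: integrable_fin_num => //.
  exact: integrable_potential.
have entropy_ge0 : (0 <= entropy_ooe F nu)%E.
  rewrite entropy_nu; apply: integral_ge0 => q _; rewrite lee_fin.
  by apply: partition_entropy_ge0 => a; exact: measurable_symbol_partition.
have [kappam km] : exists kappam, is_disintegration mu (@past_fiber_proj R A M X o x0) kappam.
  apply: (@entropy_ooe_disintegration R A M X o x0 F).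
  by rewrite gt_eqF// (lt_le_trans ltNy0 (le_trans entropy_ge0 nu_mu)).
apply: (conditional_product cX khat keta km) => n w.
apply: (@future_conditional R A M X o x0 F mu nu kappa kappam) => //.
move=> {w}n.
have h1 := integral_join_entropy cX cF Fbij Fpast nu_inv knu n.
have h2 := integral_join_entropy cX cF Fbij Fpast mu_inv km n.
(* Maximality compares one-step entropies only; as join entropies are exact multiples of these, the
   comparison extends to words of every length. *)
rewrite [leLHS]h1 [leRHS]h2; apply: lee_wpmul2l; first by rewrite lee_fin.
rewrite -(entropy_ooeE cX cF Fbij Fpast nu_inv knu).
by rewrite -(entropy_ooeE cX cF Fbij Fpast mu_inv km).
Qed.
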